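(* Let $m$ be the locally bounded solution of $$m(u)=\phi\int_0^u m(u-y)f(y)\,dy+v(u),\quad u\ge 0,$$ with $0<\phi<1$ and $f$ the density function of an absolutely continuous nonnegative random variable $Z$ with distribution function $F$. Consider the conditions: 1. $Z$ has finite variance. 2. $F$ and $v$ are in $C^2_0([0,\infty))$. 3. $f'$ and $v''$ are in $C^2([0,\infty))$. 4. $I_i(f'')<\infty$ for $i=0,2$. 5. $\|u^2w_i(u)\|<\infty$ for $i=1,2$. 6. $\|u^2w_i''(u)\|<\infty$ for $i=1,2$. If Condition 2 is satisfied and in addition $\|w_2\|<\infty$, then $$\|m''\|\le\frac{\|w_2\|}{1-\phi}<\infty.$$ If Conditions 1-6 are satisfied, then $$\|u^2m'''(u)\|\le\phi\Big((I_0(f'')+|f'(0)|)\|u^2m'(u)\|+2I_1(f'')\|um'(u)\|+I_2(f'')\|m'\|\Big)+\phi f(0)\|u^2m''(u)\|+\|u^2w_1''(u)\|<\infty$$ and $$\|u^2m^{iv}(u)\|\le\phi\Big((I_0(f'')+|f'(0)|)\|u^2m''(u)\|+2I_1(f'')\|um''(u)\|+I_2(f'')\|m''\|\Big)+\phi f(0)\|u^2m'''(u)\|+\|u^2w_2''(u)\|<\infty.$$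
   Context: Standing assumptions: $0<\phi<1$; $F$ is the distribution function of $Z\ge 0$, with $F(0)=0$; $v:[0,\infty)\to\mathbb R$ is locally bounded. The renewal equation then has a unique locally bounded solution $m$. Function classes: $C([0,\infty))$ is the class of continuous real functions on $[0,\infty)$; $C^n([0,\infty))$ is the subclass of functions in $C([0,\infty))$ having continuous $n$-th derivative on $(0,\infty)$; $C^n_0([0,\infty))$ is the subclass of $g\in C^n([0,\infty))$ such that $\lim_{t\downarrow 0}g^{(k)}(t)$ exists and is finite for all $k=0,1,\dots,n$, and then $g^{(k)}(0)$ denotes this limit. In particular, when $F\in C_0^2([0,\infty))$, $f$ denotes the version $f=F'$ on $(0,\infty)$, with $f(0),f'(0)$ the limits at $0$. Norms: $\|g\|$ is the supremum of $|g|$ over its domain (over $(0,\infty)$ for expressions involving derivatives defined only there), and $\|u^jg(u)\|$ is the supremum of $u^j|g(u)|$. A bound on the norm of a derivative includes the assertion that this derivative exists on $(0,\infty)$. $I_i(h):=\int_0^\infty y^i|h(y)|\,dy$. $w_1(u):=\phi\, m(0)f(u)+v'(u)$ and $w_2(u):=\phi\, m'(0)f(u)+w_1'(u)$, where $m'(0)=\lim_{u\downarrow 0}m'(u)$ (which exists under condition 2). *)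

(* Defs.v *)
From HB Require Import structures.
From mathcomp Require Import all_boot all_order all_algebra.
From mathcomp Require Import all_classical all_reals all_analysis.
Set Implicit Arguments.
Unset Strict Implicit.
Unset Printing Implicit Defensive.
Import Order.TTheory GRing.Theory Num.Theory.
Import numFieldNormedType.Exports.
Local Open Scope ring_scope.
Local Open Scope classical_set_scope.

(* A function on [0, +oo[ is represented by a total function R -> R; the
   definitions below look only at its values on [0, +oo[. *)

Definition locally_bounded (R : realType) (g : R -> R) : Prop :=
  forall a : R, [bounded g u | u in `[0, a]].

Definition deriv_exists (R : realType) (n : nat) (g : R -> R) : Prop :=
  forall k, (k < n)%N -> forall u : R, 0 < u -> derivable g^`(k) u 1.

Definition Cn (R : realType) (n : nat) (g : R -> R) : Prop :=
  [/\ {within `[0, +oo[, continuous g},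
      deriv_exists n g &
      forall u : R, 0 < u -> {for u, continuous g^`(n)}].

Definition C0n (R : realType) (n : nat) (g : R -> R) : Prop :=
  Cn n g /\
  forall k, (k <= n)%N -> cvg (g^`(k) u @[u --> (0 : R)^'+]).

(* The k-th derivative on [0, +oo[: its value at 0 is the limit at 0+, not the
   two-sided derivative (which would depend on g at negative arguments). *)
Definition ederiv (R : realType) (k : nat) (g : R -> R) (u : R) : R :=
  if 0 < u then g^`(k) u else lim (g^`(k) x @[x --> (0 : R)^'+]).

(* Supremum over ]0, +oo[, as it is applied to expressions that involve
   derivatives; possibly +oo. *)
Definition supnorm (R : realType) (g : R -> R) : \bar R :=
  ereal_sup [set (`|g u|)%:E | u in `]0, +oo[].

Definition wsupnorm (R : realType) (j : nat) (g : R -> R) : \bar R :=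
  supnorm (fun u => u ^+ j * g u).

Definition absmoment (R : realType) (i : nat) (h : R -> R) : \bar R :=
  (\int[@lebesgue_measure R]_(y in `]0%R, +oo[) (y ^+ i * `|h y|)%:E)%E.

Definition cdfR d (T : measurableType d) (R : realType) (P : probability T R)
    (Z : {RV P >-> R}) (x : R) : R :=
  fine (cdf Z x).

Definition is_density d (T : measurableType d) (R : realType)
    (P : probability T R) (Z : {RV P >-> R}) (f : R -> R) : Prop :=
  [/\ measurable_fun setT f,
      forall x, 0 <= f x &
      forall A : set R, measurable A ->
        distribution P Z A = (\int[@lebesgue_measure R]_(x in A) (f x)%:E)%E].

(* Integrability is what gives the equation a meaning: the library's integral
   has a value for every integrand, measurable or not. *)
Definition renewal_solution (R : realType) (phi : R) (f v m : R -> R) : Prop :=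
  forall u : R, 0 <= u ->
    (@lebesgue_measure R).-integrable `[0, u]
      (fun y => (m (u - y) * f y)%:E) /\
    m u =
      phi * (\int[@lebesgue_measure R]_(y in `[0, u]) (m (u - y) * f y)) + v u.

Definition w1 (R : realType) (phi : R) (f v m : R -> R) (u : R) : R :=
  phi * m 0 * f u + derive1 v u.

Definition w2 (R : realType) (phi : R) (f v m : R -> R) (u : R) : R :=
  phi * ederiv 1 m 0 * f u + derive1 (w1 phi f v m) u.

(* Main.v *)
(* Write f * g for the convolution on [0, u].  If G' = g is only locally
   integrable, Fubini still gives (h * G)' = G(0) h + h * g.  Letting either
   factor of m * f carry the derivative turns m = phi m * f + v into
   m' = phi m' * f + w1, and again into m'' = phi m'' * f + w2; since f has mass
   at most 1 and phi < 1, comparing with the maximum over [0, u] bounds m''.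
   For m''' and m'''' the kernel is differentiated twice instead:
     m''' = phi (f(0) m'' + f'(0) m' + m' * f'') + w1'',
   and u^2 = (u - y)^2 + 2 (u - y) y + y^2 bounds u^2 (m' * f'')(u).  A
   similar splitting of u^2 in m' = phi m' * f + w1, with E Z^2 finite, shows
   that the weighted norms on the right are finite.
   A solution m is not assumed measurable or continuous: measurability comes
   from that of y |-> m (u - y) f y on an interval where f > 0, and continuity
   of m then follows from that of f. *)
Require Import Defs.
From HB Require Import structures.
From mathcomp Require Import all_boot all_order all_algebra.
From mathcomp Require Import all_classical all_reals all_analysis.
From mathcomp Require Import measurable_realfun ring lra.
Import Order.TTheory GRing.Theory Num.Theory.
Import numFieldNormedType.Exports.
Local Open Scope ring_scope.
Local Open Scope classical_set_scope.
Set Implicit Arguments.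
Unset Strict Implicit.
Unset Printing Implicit Defensive.

(** * Reflections, translations and convolution on the half-line *)

Section invariance.
Context {R : realType}.
Local Notation mu := (@lebesgue_measure R).
Local Notation RT := (measurableTypeR R).

Lemma measurable_reflection (c : R) :
  measurable_fun [set: RT] ((fun y => c - y) : RT -> RT).
Proof. by apply: measurable_funB => //; exact: measurable_cst. Qed.

Lemma measurable_translation (c : R) :
  measurable_fun [set: RT] ((fun y => y - c) : RT -> RT).
Proof. by apply: measurable_funB => //; exact: measurable_cst. Qed.

(** Lebesgue measure is determined by its values on half-open intervals, and a reflection maps []a,
    b]] to an interval of the same length. *)
Lemma lebesgue_measure_reflection (c : R) (A : set R) : measurable A ->
  pushforward mu ((fun y => c - y) : RT -> RT) A = mu A.
Proof.
move=> mA; apply/esym/lebesgue_measure_unique => //.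
  exact: measurable_reflection.
move=> mr _ [[a b]] _ <-.
rewrite /pushforward /=.
rewrite [X in _ = mu X](_ : _ = `[c - b, c - a[%classic); last first.
  by apply/seteqP; split => y /=; rewrite !in_itv/= => /andP[? ?];
    apply/andP; split; lra.
rewrite !lebesgue_measure_itv/= !lte_fin.
have -> : (c - b < c - a) = (a < b) by apply/idP/idP => ?; lra.
by case: ifP => // _; rewrite -!EFinB; congr EFin; lra.
Qed.

Lemma lebesgue_measure_translation (c : R) (A : set R) : measurable A ->
  pushforward mu ((fun y => y - c) : RT -> RT) A = mu A.
Proof.
move=> mA; apply/esym/lebesgue_measure_unique => //.
  exact: measurable_translation.
move=> mr _ [[a b]] _ <-.
rewrite /pushforward /=.
rewrite [X in _ = mu X](_ : _ = `]a + c, b + c]%classic); last first.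
  by apply/seteqP; split => y /=; rewrite !in_itv/= => /andP[? ?];
    apply/andP; split; lra.
rewrite !lebesgue_measure_itv/= !lte_fin.
have -> : (a + c < b + c) = (a < b) by apply/idP/idP => ?; lra.
by case: ifP => // _; rewrite -!EFinB; congr EFin; lra.
Qed.

Section preserving.
Variable phi : RT -> RT.
Hypothesis mphi : measurable_fun setT phi.
Hypothesis phiE : forall A, measurable A -> pushforward mu phi A = mu A.

Lemma integrable_preserving (D : set R) (g : R -> R) : measurable D ->
  mu.-integrable D (EFin \o g) ->
  mu.-integrable (phi @^-1` D) (EFin \o (g \o phi)).
Proof.
move=> mD /integrableP[mg ig].
have mpD : measurable (phi @^-1` D).
  by rewrite -[X in measurable X]setTI; exact: mphi.
apply/integrableP; split.
  apply: (measurable_comp mD _ mg); first by move=> _ [x Dx <-].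
  exact: measurable_funTS.
rewrite -[ltLHS]/(\int[mu]_(x in phi @^-1` D) ((fun y => `|(g y)%:E|%E) \o phi) x)%E.
rewrite -(ge0_integral_pushforward mphi mu) => //; last exact: measurableT_comp.
by rewrite (eq_measure_integral mu)// => A mA _; exact: phiE.
Qed.

(** The pushforward formula is applied on the whole line, to [g] cut off outside [D]. *)
Lemma Rintegral_preserving (D : set R) (g : R -> R) : measurable D ->
  mu.-integrable D (EFin \o g) ->
  \int[mu]_(x in phi @^-1` D) g (phi x) = \int[mu]_(x in D) g x.
Proof.
move=> mD ig; rewrite [RHS]Rintegral_mkcond [LHS]Rintegral_mkcond /Rintegral.
have mgD : measurable_fun setT (EFin \o (g \_ D)).
  apply/measurable_EFinP; apply/(measurable_restrictT _ _).1 => //.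
  by apply/measurable_EFinP; exact: measurable_int ig.
have E : (EFin \o (g \_ D)) = ((EFin \o g) \_ D)%E.
  by apply/funext => x /=; rewrite !patchE; case: ifP.
have iT : mu.-integrable setT (EFin \o (g \_ D)).
  by rewrite E; apply: (integrable_mkcond _ _).1.
have := integrable_preserving measurableT iT; rewrite preimage_setT => iphi.
have /= := (@integral_pushforward _ _ _ _ _ _ mphi mu setT _ mgD).
rewrite preimage_setT => /(_ iphi measurableT).
rewrite (eq_measure_integral mu); last by move=> A mA _; exact: phiE.
by move=> ->; congr fine; apply: eq_integral => x _; rewrite /= !patchE.
Qed.
End preserving.

End invariance.

(** * Continuity, local integrability and convolution of functions on the half-line *)

Definition pcont (R : realType) (h : R -> R) : Prop :=
  {within `[0, +oo[, continuous h}.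

(** Weak enough for a kernel that is unbounded near 0, as the second derivative of [f] may be. *)
Definition lint (R : realType) (g : R -> R) : Prop :=
  forall a : R, (@lebesgue_measure R).-integrable `[0, a] (EFin \o g).

Definition conv (R : realType) (h g : R -> R) (u : R) : R :=
  \int[@lebesgue_measure R]_(y in `[0, u]) (h (u - y) * g y).

Section halfline.
Context {R : realType}.
Implicit Types (h g : R -> R) (a u : R).
Local Notation mu := (@lebesgue_measure R).

(** Extending [h] by its value at 0 to negative arguments gives a function continuous on the whole
    line, to which the usual algebra of limits applies. *)
Lemma pcontP h : pcont h <-> continuous (fun x : R => h (Num.max 0 x)).
Proof.
split=> ch.
  move=> x.
  set z := Num.max 0 x.
  have z0 : 0 <= z by rewrite /z le_max lexx.
  have zA : (`[0, +oo[%classic : set R) z by rewrite /= in_itv/= z0.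
  have hz : h y @[y --> within (`[0, +oo[ : set R) (nbhs z)] --> h z.
    by have := ch z; rewrite /continuous_at /prop_for nbhs_subspace_in.
  apply: (cvg_comp (fun y => Num.max 0 y) h _ hz) => P.
  rewrite /within/= => nP.
  have cm : Num.max 0 y @[y --> x] --> z.
    by apply: continuous_max; [exact: cvg_cst|exact: cvg_id].
  have H : \forall y \near x, `[0, +oo[%classic (Num.max 0 y) -> P (Num.max 0 y).
    exact: cm _ nP.
  apply: filterS H => y; apply.
  by rewrite /= in_itv/= le_max lexx.
apply: (@subspace_eq_continuous _ _ _ (fun x : R => h (Num.max 0 x))).
  move=> x; rewrite inE/= in_itv/= andbT => x0.
  by rewrite max_r.
exact: continuous_subspaceT.
Qed.

Lemma pcontW h a : pcont h -> {within `[0, a], continuous h}.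
Proof. by apply: continuous_subspaceW; exact: subset_itvl. Qed.

Lemma pcont_bounded h a : pcont h ->
  exists2 C, 0 <= C & forall x, 0 <= x <= a -> `|h x| <= C.
Proof.
move=> /(@pcontW _ a) ch.
have := continuous_compact ch (@segment_compact _ 0 a).
move=> /compact_bounded[M [Mr /(_ (`|M| + 1))]].
have H : M < `|M| + 1 by rewrite (le_lt_trans (ler_norm _))// ltrDl.
move=> /(_ H) /= hM; exists (`|M| + 1) => // x xa.
by apply: hM; exists x => //=; rewrite in_itv.
Qed.

Lemma pcont_lint h : pcont h -> lint h.
Proof.
move=> ch a; apply: continuous_compact_integrable; first exact: segment_compact.
exact: pcontW.
Qed.

Lemma lint_measurable g a : lint g -> measurable_fun `[0, a] g.
Proof. by move=> /(_ a) /measurable_int/measurable_EFinP. Qed.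

Lemma lintS g a (D : set (measurableTypeR R)) : measurable D ->
  D `<=` `[0, a] -> lint g ->
  mu.-integrable D (EFin \o g).
Proof. by move=> mD Da /(_ a); apply: integrableS. Qed.

Lemma integrable_bounded_mul (D : set (measurableTypeR R)) h g (C : R) : measurable D ->
  measurable_fun D h -> (forall x, D x -> `|h x| <= C) ->
  mu.-integrable D (EFin \o g) -> mu.-integrable D (EFin \o (fun x => h x * g x)).
Proof.
move=> mD mh hC ig.
apply: (integrableMr mD mh _ ig).
exists C; split; first exact: num_real.
by move=> x Cx y Dy; exact: le_trans (hC _ Dy) (ltW Cx).
Qed.

Lemma integrable_cstM (D : set (measurableTypeR R)) g (c : R) : measurable D ->
  mu.-integrable D (EFin \o g) -> mu.-integrable D (EFin \o (fun x => c * g x)).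
Proof. by move=> mD /(integrableZl mD c); exact: eq_integrable. Qed.

Lemma integrable_Mcst (D : set (measurableTypeR R)) g (c : R) : measurable D ->
  mu.-integrable D (EFin \o g) -> mu.-integrable D (EFin \o (fun x => g x * c)).
Proof. by move=> mD /(integrableZr mD c); exact: eq_integrable. Qed.

Lemma integrable_add (D : set (measurableTypeR R)) h g : measurable D ->
  mu.-integrable D (EFin \o h) -> mu.-integrable D (EFin \o g) ->
  mu.-integrable D (EFin \o (fun x => h x + g x)).
Proof. by move=> mD ih ig; have := integrableD mD ih ig; exact: eq_integrable. Qed.

Lemma preimage_reflection u :
  (fun y : R => u - y) @^-1` `[0, u] = (`[0, u]%classic : set R).
Proof.
by apply/seteqP; split => y /=; rewrite !in_itv/= => /andP[? ?];
  apply/andP; split; lra.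
Qed.

Lemma integrable_reflection g u : mu.-integrable `[0, u] (EFin \o g) ->
  mu.-integrable `[0, u] (EFin \o (fun y => g (u - y))).
Proof.
move=> ig; rewrite -preimage_reflection.
apply: (integrable_preserving (measurable_reflection u) _ _ ig) => //.
by move=> A; exact: lebesgue_measure_reflection.
Qed.

Lemma Rintegral_reflection g u : mu.-integrable `[0, u] (EFin \o g) ->
  \int[mu]_(y in `[0, u]) g (u - y) = \int[mu]_(y in `[0, u]) g y.
Proof.
move=> ig; rewrite -[in LHS]preimage_reflection.
apply: (Rintegral_preserving (measurable_reflection u) _ _ ig) => //.
by move=> A; exact: lebesgue_measure_reflection.
Qed.

Lemma measurable_fun_reflection g u : measurable_fun `[0, u] g ->
  measurable_fun `[0, u] (fun y => g (u - y)).
Proof.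
move=> mg; apply: (measurable_comp _ _ mg) => //.
  by rewrite -{1}preimage_reflection => _ [x Dx <-].
by apply: measurable_funTS; exact: measurable_reflection.
Qed.

(** This is what can be shown of the solution [m] before its continuity; it is enough for
    convolutions with [m] to commute. *)
Definition bounded_lint h := lint h /\ 
  forall a, exists2 C, 0 <= C & forall x, 0 <= x <= a -> `|h x| <= C.

Lemma pcont_bounded_lint h : pcont h -> bounded_lint h.
Proof. by move=> ch; split; [exact: pcont_lint|move=> a; exact: pcont_bounded]. Qed.

Lemma integrable_conv h g u : bounded_lint h -> lint g ->
  mu.-integrable `[0, u] (EFin \o (fun y => h (u - y) * g y)).
Proof.
move=> [ih bh] ig; have [C C0 hC] := bh u.
apply: (@integrable_bounded_mul _ _ _ C) => //.
  by apply: measurable_fun_reflection; exact: lint_measurable.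
by move=> x /=; rewrite in_itv/= => /andP[? ?]; apply: hC; apply/andP; split; lra.
Qed.

Lemma convC h g u : bounded_lint h -> lint g -> conv h g u = conv g h u.
Proof.
move=> bh ig; rewrite /conv -(Rintegral_reflection (integrable_conv u bh ig)).
by apply: eq_Rintegral => y _; rewrite opprB addrC subrK mulrC.
Qed.

Lemma conv_max0 h g u : conv h g u = conv (fun x : R => h (Num.max 0 x)) g u.
Proof.
apply: eq_Rintegral => y; rewrite inE/= in_itv/= => /andP[? ?].
by rewrite max_r// subr_ge0.
Qed.

End halfline.

(** * Differentiating a convolution *)

Section calculus.
Context {R : realType}.
Implicit Types (h g : R -> R) (a u : R).
Local Notation mu := (@lebesgue_measure R).

Definition prim (g : R -> R) (x : R) : R := \int[mu]_(y in `[0, x]) g y.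

Lemma prim0 g : prim g 0 = 0.
Proof. by rewrite /prim set_itv1 Rintegral_set1. Qed.

Lemma pcont_within h : (forall a, 0 < a -> {within `[0, a], continuous h}) ->
  pcont h.
Proof.
move=> ch; apply/continuous_within_itvcyP; split.
  move=> x; rewrite in_itv/= andbT => x0.
  have x1 : 0 < x + 1 by rewrite ltr_wpDr.
  have /(continuous_within_itvP _ x1)[+ _ _] := ch _ x1.
  by apply; rewrite in_itv/= x0 ltrDl ltr01.
by have /(continuous_within_itvP _ ltr01)[] := ch 1 ltr01.
Qed.

Lemma pcont_for h u : pcont h -> 0 < u -> {for u, continuous h}.
Proof.
move=> /continuous_within_itvcyP[ch _] u0.
by apply: ch; rewrite in_itv/= u0.
Qed.

Lemma pcont_prim g : lint g -> pcont (prim g).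
Proof.
move=> ig; apply: pcont_within => a a0.
exact: (parameterized_integral_continuous (ltW a0) (ig a)).
Qed.

Lemma is_derive_prim h u : lint h -> {for u, continuous h} -> 0 < u ->
  is_derive u 1 (prim h) (h u).
Proof.
move=> ih ch u0.
have uu : u < u + 1 by rewrite ltrDl.
have [d e] := continuous_FTC1_closed uu (ih (u + 1)) u0 ch.
by apply: DeriveDef => //; rewrite -derive1E.
Qed.

Lemma is_derive_continuous h u (d : R) : is_derive u (1 : R) h d ->
  {for u, continuous h}.
Proof.
by move=> [dh _]; apply/differentiable_continuous/derivable1_diffP.
Qed.

Lemma pcontD h g : pcont h -> pcont g -> pcont (fun x => h x + g x).
Proof.
move=> /pcontP ch /pcontP cg; apply/pcontP => x.
exact: (cvgD (ch x) (cg x)).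
Qed.

Lemma pcontM h g : pcont h -> pcont g -> pcont (fun x => h x * g x).
Proof.
move=> /pcontP ch /pcontP cg; apply/pcontP => x.
exact: (cvgM (ch x) (cg x)).
Qed.

Lemma pcontZ (c : R) h : pcont h -> pcont (fun x => c * h x).
Proof.
move=> ch; apply: (@pcontM (fun=> c)) => //.
by apply/pcontP => x; exact: cvg_cst.
Qed.

Lemma eq_pcont h g : (forall x, 0 <= x -> h x = g x) -> pcont h -> pcont g.
Proof.
move=> hg; apply: subspace_eq_continuous => x.
by rewrite inE/= in_itv/= andbT => /hg.
Qed.

(** As [g] may be unbounded near 0, the mean value theorem is applied to [h - prim g], which is
    continuous on [[0, u]] and has derivative 0 inside. *)
Lemma FTC2_halfline h g : pcont h -> lint g ->
  (forall x : R, 0 < x -> is_derive x 1 h (g x)) ->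
  (forall x : R, 0 < x -> {for x, continuous g}) ->
  forall u, 0 <= u -> h u = h 0 + prim g u.
Proof.
move=> ch ig hg cg u; rewrite le_eqVlt => /predU1P[<-|u0].
  by rewrite prim0 addr0.
have cD : {within `[0, u], continuous (fun x => h x - prim g x)}.
  apply: pcontW; apply: (eq_pcont (h := fun x => h x + -1 * prim g x)).
    by move=> x _; rewrite mulN1r.
  by apply: pcontD => //; apply: pcontZ; exact: pcont_prim.
have [|c _] := @MVT _ (fun x => h x - prim g x) (fun=> 0) _ _ u0 _ cD.
  move=> x; rewrite in_itv/= => /andP[x0 _].
  have := is_deriveB (hg x x0) (is_derive_prim ig (cg x x0) x0).
  by rewrite subrr.
rewrite mul0r prim0 => /eqP.
by rewrite subr_eq0 subr0 subr_eq addrC => /eqP ->; rewrite addrC.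
Qed.

Lemma RintegralB_itv g u a : lint g -> 0 <= u <= a ->
  \int[mu]_(y in `]u, a]) g y = prim g a - prim g u.
Proof.
move=> ig /andP[u0 ua]; rewrite -(Rintegral_itvB (ig a))//.
Qed.

(** With [h] extended by [h 0], the integral can be taken over the fixed interval [[0, a]], where
    dominated convergence gives continuity in [x]. The surplus over []x, a]] is [h 0] times a
    difference of primitives of [g], again continuous. *)
Lemma pcont_conv h g : pcont h -> lint g -> pcont (conv h g).
Proof.
move=> ch ig; apply: pcont_within => a a0.
pose hc := fun x : R => h (Num.max 0 x).
have chc : continuous hc by apply/pcontP.
(* The parameter will range over the open interval from [-a] to [2a], which contains [[0, a]]; hence
   a bound up to [2a]. *)
have [C C0 hC] := pcont_bounded (a + a) ch.
have hcC x : x <= a + a -> `|hc x| <= C.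
  by move=> xa; apply: hC; rewrite le_max lexx/= ge_max xa addr_ge0 ?ltW.
have ihg x : x <= a + a ->
    mu.-integrable `[0, a] (EFin \o (fun y => hc (x - y) * g y)).
  move=> xa; apply: (@integrable_bounded_mul _ _ _ _ C) => //.
    apply: measurable_funTS; apply: continuous_measurable_fun => y.
    apply: continuous_comp; last exact: chc.
    by apply: continuousB; [exact: cst_continuous|].
  by move=> y /=; rewrite in_itv/= => /andP[y0 ya]; apply: hcC; lra.
pose Fa (x : R) : R := \int[mu]_(y in `[0, a]) (hc (x - y) * g y).
have cF : {in `]- a, a + a[, continuous Fa}.
  move=> x xI.
  apply: (@continuity_under_integral R _ _ mu (fun x y => hc (x - y) * g y)
    `[0, a]%classic _ (- a) (a + a) _ _ (fun y => C * `|g y|)) => //.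
  - by move=> z /=; rewrite in_itv/= => /andP[_ ?]; apply: ihg; exact: ltW.
  - apply: aeW => y _ z _; apply: cvgM; last exact: cvg_cst.
    apply: (@cvg_comp _ _ _ (fun z : R => z - y) hc _ _ _ _ (chc _)).
    by apply: cvgB; [exact: cvg_id|exact: cvg_cst].
  - apply: (@integrable_bounded_mul _ _ _ _ C) => //.
      by move=> z _; rewrite ger0_norm.
    exact: integrable_norm.
  - move=> z /=; rewrite in_itv/= => /andP[_ za]; apply: aeW => y /=.
    rewrite in_itv/= => /andP[y0 ya]; rewrite normrM ler_wpM2r//.
    by apply: hcC; lra.
apply: (subspace_eq_continuous
  (f := fun x => Fa x - h 0 * (prim g a - prim g x))).
  move=> x; rewrite inE/= in_itv/= => /andP[x0 xa].
  rewrite /from_subspace /Fa conv_max0 -/hc /conv.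
  have xaa : x <= a + a by lra.
  apply/eqP; rewrite subr_eq addrC -subr_eq.
  rewrite (Rintegral_itvB (ihg x xaa))// -RintegralB_itv ?x0//.
  rewrite -RintegralZl//; last first.
    by apply: (lintS (a := a)) => //; apply: subset_itvr; rewrite bnd_simp.
  apply/eqP; apply: eq_Rintegral => y; rewrite inE/= in_itv/= => /andP[xy _].
  by rewrite /hc max_l// subr_le0 ltW.
have c1 : {within `[0, a], continuous Fa}.
  apply: continuous_in_subspaceT => x /set_mem/=; rewrite in_itv/= => /andP[? ?].
  by apply: cF; apply/mem_set; rewrite /= in_itv/=; lra.
have c2 : {within `[0, a], continuous (prim g)} by apply: pcontW; exact: pcont_prim.
move=> x.
exact: (cvgB (c1 x) (cvgM (cvg_cst _) (cvgB (cvg_cst _) (c2 x)))).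
Qed.

End calculus.

(** * Primitives of convolutions, by Fubini *)

Section fubini.
Context {R : realType}.
Implicit Types (h g : R -> R) (a u : R).
Local Notation mu := (@lebesgue_measure R).
Local Notation RT := (measurableTypeR R).

(** The order of integration is exchanged over the triangle [0 <= y <= t <= u]. Cutting both factors
    off outside [[0, u]] turns the integral over it into one over the plane. *)
Lemma prim_conv h g u : lint h -> bounded_lint g ->
  prim (conv h g) u = conv (prim h) g u.
Proof.
move=> ih bg; have ig := bg.1.
pose D : set RT := `[0, u]%classic.
have mD : measurable D by exact: measurable_itv.
have mp (k : R -> R) : lint k -> measurable_fun [set: RT] (k \_ D).
  move=> ik; apply/(measurable_restrictT _ _).1 => //.
  exact: lint_measurable.
have ip (k : R -> R) : lint k -> mu.-integrable setT (EFin \o (k \_ D)).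
  move=> ik; rewrite -restrict_EFin.
  by apply: (integrable_mkcond _ _).1 => //; exact: ik.
pose F : RT * RT -> \bar R :=
  fun z => ((h \_ D) (z.1 - z.2) * (g \_ D) z.2 * \1_D z.1)%:E.
have mF : measurable_fun setT F.
  apply/measurable_EFinP; apply: measurable_funM; first apply: measurable_funM.
  - apply: (measurable_comp _ _ (mp _ ih)) => //.
    by apply: measurable_funB; [exact: measurable_fst|exact: measurable_snd].
  - by apply: (measurable_comp _ _ (mp _ ig)) => //; exact: measurable_snd.
  - have m1 : measurable_fun [set: RT] (\1_D : RT -> R) by exact: measurable_indic.
    exact: (measurableT_comp m1 measurable_fst).
have shiftI (k : R -> R) y : mu.-integrable setT (EFin \o k) ->
    mu.-integrable setT (EFin \o (fun t => k (t - y))).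
  move=> ik; rewrite -[setT](preimage_setT (fun t : R => t - y)).
  apply: (integrable_preserving (measurable_translation y) _ _ ik) => //.
  by move=> A; exact: lebesgue_measure_translation.
pose K := \int[mu]_t `|(h \_ D) t|.
(* By translation invariance the integral of [|F|] in the first variable is at most [|g y|] times
   the constant [K], and [g] is integrable on [[0, u]]. *)
have iF : (mu \x mu)%E.-integrable setT F.
  apply/integrable21ltyP => //.
  apply: (@le_lt_trans _ _ (\int[mu]_y (`|(g \_ D) y| * K)%:E)%E).
    apply: ge0_le_integral => //.
    
    - by move=> y _; exact: integral_ge0.
    - have maF : measurable_fun setT (abse \o F) by exact: measurableT_comp.
      have F0 z : (0 <= (abse \o F) z)%E by exact: abse_ge0.
      exact: (measurable_fun_fubini_tonelli_G (m1 := mu) _ maF F0).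
    - apply/measurable_EFinP; apply: measurable_funM => //.
      by apply: measurableT_comp => //; exact: mp.
    move=> y _.
    have ihy := integrable_norm (shiftI _ y (ip _ ih)).
    apply: (@le_trans _ _ (\int[mu]_t (`|(h \_ D) (t - y)| * `|(g \_ D) y|)%:E)%E).
      apply: ge0_le_integral => //.
      - apply: measurableT_comp => //.
        by apply: (measurable_comp _ _ mF) => //; exact: measurable_pair2.
      - apply/measurable_EFinP; apply: measurable_funM => //.
        by have /measurable_EFinP := measurable_int _ ihy.
      move=> t _; rewrite /F/= lee_fin !normrM ler_piMr// ?mulr_ge0//.
      by rewrite indicE; case: (_ \in _); rewrite ?normr0 ?normr1.
    have -> : K = \int[mu]_t `|(h \_ D) (t - y)|.
      have := Rintegral_preserving (measurable_translation y)
        (lebesgue_measure_translation y) measurableT (integrable_norm (ip _ ih)).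
      by rewrite preimage_setT => /esym.
    rewrite mulrC -RintegralZr//.
    rewrite /Rintegral fineK//.
    apply: integrable_fin_num => //.
    exact: integrable_Mcst ihy.
  have := integrableZr measurableT K (integrable_norm (ip _ ig)).
  move=> /integrable_lty.
  by apply.
rewrite /conv [LHS]/prim [LHS]/Rintegral [RHS]/Rintegral; congr fine.
transitivity (\int[mu]_t \int[mu]_y F (t, y))%E.
  rewrite integral_mkcond; apply: eq_integral => t _.
  rewrite patchE; case: ifPn => tD; last first.
    by rewrite integral0_eq// => y _; rewrite /F/= indicE (negbTE tD) mulr0.
  have /andP[t0 tu] : 0 <= t <= u by move/set_mem : tD; rewrite /= in_itv.
  (* Boundedness of [g] makes the inner integral finite for every [t], not only for almost every
     [t], so that its real value agrees with the extended one. *)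
  have ic : mu.-integrable `[0, t] (EFin \o (fun y => h (t - y) * g y)).
    have := integrable_reflection (integrable_conv t bg ih).
    by apply: eq_integrable => // y _ /=; rewrite opprB addrC subrK mulrC.
  rewrite /= /Rintegral fineK; last exact: integrable_fin_num ic.
  rewrite integral_mkcond; apply: eq_integral => y _.
  rewrite patchE /F/= !patchE indicE tD mulr1.
  have -> : (y \in (`[0, t]%classic : set R)) = (t - y \in D) && (y \in D).
    by apply/idP/andP => [/set_mem|[/set_mem + /set_mem]];
      rewrite /D/= !in_itv/=; [move=> /andP[? ?]; split; apply/mem_set|
       move=> /andP[? ?] /andP[? ?]; apply/mem_set];
      rewrite /= in_itv/=; apply/andP; split; lra.
  by case: ifPn => [/andP[-> ->]//|]; rewrite negb_and => /orP[] /negbTE ->;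
    rewrite ?mul0r ?mulr0.
rewrite (Fubini iF).
rewrite [RHS]integral_mkcond; apply: eq_integral => y _.
rewrite patchE; case: ifPn => yD; last first.
  have {}yD : (y \in D) = false by exact/negbTE.
  by rewrite integral0_eq// => t _; rewrite /F/= [(g \_ D) y]patchE yD mulr0 mul0r.
have /andP[y0 yu] : 0 <= y <= u by move/set_mem : yD; rewrite /= in_itv.
have piE : (fun t : R => t - y) @^-1` `[0, u - y] = (`[y, u]%classic : set R).
  by apply/seteqP; split => t /=; rewrite !in_itv/= => /andP[? ?];
    apply/andP; split; lra.
have ihy : mu.-integrable `[y, u] (EFin \o (fun t => h (t - y))).
  rewrite -piE.
  apply: (integrable_preserving (measurable_translation y) _ _ (ih _)) => //.
  by move=> A; exact: lebesgue_measure_translation.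
have <- : \int[mu]_(t in `[y, u]) h (t - y) = prim h (u - y).
  rewrite -piE (Rintegral_preserving (measurable_translation y) _ _ (ih _))//.
  by move=> A; exact: lebesgue_measure_translation.
rewrite -RintegralZr// /Rintegral fineK; last first.
  apply: integrable_fin_num => //.
  exact: integrable_Mcst ihy.
rewrite [RHS]integral_mkcond; apply: eq_integral => t _.
rewrite patchE /F/= !patchE yD indicE.
have -> : (t \in (`[y, u]%classic : set R)) = (t - y \in D) && (t \in D).
  by apply/idP/andP => [/set_mem|[/set_mem + /set_mem]];
    rewrite /D/= !in_itv/=; [move=> /andP[? ?]; split; apply/mem_set|
     move=> /andP[? ?] /andP[? ?]; apply/mem_set];
    rewrite /= in_itv/=; apply/andP; split; lra.
by case: (t - y \in D); case: (t \in D); rewrite /= ?mulr1 ?mul0r ?mulr0.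
Qed.

Lemma conv_prim h g u : pcont h -> lint g ->
  conv h (prim g) u = prim (conv h g) u.
Proof.
move=> ch ig.
have bh := pcont_bounded_lint ch.
rewrite (convC _ bh) -?prim_conv//; last exact: pcont_lint (pcont_prim ig).
by rewrite /prim; apply: eq_Rintegral => y _; rewrite [RHS]convC.
Qed.

(* [g] may be unbounded near 0, so one does not differentiate under the
   integral: Fubini exhibits [conv h k] as a primitive of the right-hand side. *)
Lemma is_derive_conv h k g u : pcont h -> lint g ->
  (forall x, 0 <= x -> k x = k 0 + prim g x) ->
  0 < u -> is_derive u (1 : R) (conv h k) (k 0 * h u + conv h g u).
Proof.
move=> ch ig kE u0.
have bh := pcont_bounded_lint ch; have ih := bh.1.
have chg := pcont_conv ch ig.
have E x : conv h k x = k 0 * prim h x + prim (conv h g) x.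
  rewrite -conv_prim//.
  have -> : prim h x = \int[mu]_(y in `[0, x]) h (x - y).
    by rewrite (Rintegral_reflection (ih x)).
  rewrite -RintegralZl//; last exact: integrable_reflection.
  rewrite /conv -RintegralD//.
  - apply: eq_Rintegral => y; rewrite inE/= in_itv/= => /andP[y0 _].
    by rewrite kE// mulrDr mulrC.
  - by apply: integrable_cstM => //; exact: integrable_reflection.
  - by apply: integrable_conv => //; exact: pcont_lint (pcont_prim ig).
have -> : conv h k = (fun x => k 0 *: prim h x + prim (conv h g) x).
  by apply/funext => x; rewrite E.
apply: is_deriveD.
  by apply: is_deriveZ; apply: is_derive_prim => //; exact: pcont_for.
by apply: is_derive_prim => //; [exact: pcont_lint|exact: pcont_for].
Qed.

End fubini.

(** * The renewal equation *)

Section renewal.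
Context {R : realType}.
Implicit Types (h g : R -> R) (a u : R).
Local Notation mu := (@lebesgue_measure R).

Lemma near_eq_gt0 h g u : (forall x, 0 < x -> h x = g x) -> 0 < u ->
  \near u, h u = g u.
Proof.
by move=> hg u0; near=> x; apply: hg; near: x; exact: lt_nbhsr.
Unshelve. all: by end_near. Qed.

Lemma is_derive_eq_gt0 h g u (d : R) : (forall x, 0 < x -> h x = g x) ->
  0 < u -> is_derive u (1 : R) h d -> is_derive u (1 : R) g d.
Proof. by move=> hg u0; apply: near_eq_is_derive; exact: near_eq_gt0. Qed.

Lemma is_derive_unique h u (d e : R) :
  is_derive u (1 : R) h d -> is_derive u (1 : R) h e -> d = e.
Proof. by move=> [_ <-] [_ <-]. Qed.

Lemma conv0 h g : conv h g 0 = 0.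
Proof. by rewrite /conv set_itv1 Rintegral_set1. Qed.

(** The kernel [f] carries the derivative, so continuity of [m] is all that is asked of the
    solution. *)
Lemma is_derive_renewal (phi : R) (f f1 v m : R -> R) u (dv : R) :
  pcont m -> pcont f -> lint f1 ->
  (forall x : R, 0 < x -> is_derive x 1 f (f1 x)) ->
  (forall x : R, 0 < x -> {for x, continuous f1}) ->
  (forall x, 0 <= x -> m x = phi * conv m f x + v x) ->
  0 < u -> is_derive u (1 : R) v dv ->
  is_derive u (1 : R) m (phi * (f 0 * m u + conv m f1 u) + dv).
Proof.
move=> cm cf if1 df cf1 mE u0 vdv.
apply: (@is_derive_eq_gt0 (fun x => phi *: conv m f x + v x)) => //.
  by move=> x x0; rewrite (mE x (ltW x0)).
apply: is_deriveD; apply: is_deriveZ; apply: is_derive_conv => //.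
exact: FTC2_halfline.
Qed.

(** Two passes. Differentiating the kernel shows that [m] has a derivative, continuous up to 0. Only
    then may [m] itself carry the derivative, and equating the two results gives a renewal equation
    for [m1]. *)
Lemma renewal_derivative (phi : R) (f f1 v v1 m : R -> R) :
  pcont m -> pcont f -> pcont f1 -> pcont v1 ->
  (forall x : R, 0 < x -> is_derive x 1 f (f1 x)) ->
  (forall x : R, 0 < x -> is_derive x 1 v (v1 x)) ->
  (forall u, 0 <= u -> m u = phi * conv m f u + v u) ->
  exists m1 : R -> R, [/\ pcont m1,
    forall x : R, 0 < x -> is_derive x 1 m (m1 x) &
    forall u, 0 <= u -> m1 u = phi * conv m1 f u + (phi * m 0 * f u + v1 u)].
Proof.
move=> cm cf cf1 cv1 df dv mE.
pose m1 u := phi * (f 0 * m u + conv m f1 u) + v1 u.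
have cm1 : pcont m1.
  apply: pcontD => //; apply: pcontZ; apply: pcontD; first exact: pcontZ.
  by apply: pcont_conv => //; exact: pcont_lint.
have dm (x : R) : 0 < x -> is_derive x (1 : R) m (m1 x).
  move=> x0; apply: (@is_derive_renewal phi f f1 v m x (v1 x)) => //.
  - exact: pcont_lint.
  - by move=> y y0; exact: pcont_for.
  - exact: dv.
exists m1; split=> // u; rewrite le_eqVlt => /predU1P[<-|u0].
  (* At 0 both convolutions vanish, and the two formulas for [m1] agree. *)
  by rewrite /m1 !conv0; ring.
apply: (is_derive_unique (dm _ u0)).
(* Second pass: the convolution is commuted, and [m] is now the primitive of [m1] up to the constant
   [m 0]. *)
apply: (@is_derive_eq_gt0 (fun x => phi *: conv f m x + v x)) => //.
  move=> x x0; rewrite (mE x (ltW x0)) convC//; first exact: pcont_bounded_lint.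
  exact: pcont_lint.
have im1 := pcont_lint cm1.
have mE1 := FTC2_halfline cm im1 dm (fun y y0 => pcont_for cm1 y0).
have H := is_derive_conv cf im1 mE1 u0.
have -> : phi * conv m1 f u + (phi * m 0 * f u + v1 u) =
    phi *: (m 0 * f u + conv f m1 u) + v1 u.
  rewrite (convC u (pcont_bounded_lint cf) im1) /GRing.scale/=; ring.
by apply: is_deriveD; exact: dv.
Qed.

(** The formula for [m1] given by [is_derive_renewal] is differentiated once more, again in the
    kernel. Applied to the equations of the first and second derivatives of the solution, this
    yields the third and fourth. *)
Lemma renewal_derivative2 (phi : R) (f f1 f2 v v1 m m1 : R -> R) u (dv1 : R) :
  pcont m -> pcont f -> pcont f1 -> lint f2 ->
  (forall x : R, 0 < x -> is_derive x 1 f (f1 x)) ->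
  (forall x : R, 0 < x -> is_derive x 1 f1 (f2 x)) ->
  (forall x : R, 0 < x -> {for x, continuous f2}) ->
  (forall x : R, 0 < x -> is_derive x 1 m (m1 x)) ->
  (forall x : R, 0 < x -> is_derive x 1 v (v1 x)) ->
  (forall x, 0 <= x -> m x = phi * conv m f x + v x) ->
  0 < u -> is_derive u (1 : R) v1 dv1 ->
  is_derive u (1 : R) m1
    (phi * (f 0 * m1 u + f1 0 * m u + conv m f2 u) + dv1).
Proof.
move=> cm cf cf1 if2 df df1 cf2 dm dv mE u0 vdv.
apply: (@is_derive_eq_gt0 (fun x => phi *: (f 0 *: m x + conv m f1 x) + v1 x)) => //.
  move=> x x0; apply/esym/(is_derive_unique (dm x x0)).
  apply: (@is_derive_renewal phi f f1 v m x (v1 x)) => //.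
  - exact: pcont_lint.
  - by move=> y y0; exact: pcont_for.
  - exact: dv.
apply: is_deriveD; apply: is_deriveZ; rewrite -addrA; apply: is_deriveD.
  by apply: is_deriveZ; exact: dm.
by apply: is_derive_conv => //; exact: FTC2_halfline.
Qed.

End renewal.

(** * Weighted bounds for convolutions and for solutions of renewal equations *)

Section estimates.
Context {R : realType}.
Implicit Types (h g : R -> R) (a u : R).
Local Notation mu := (@lebesgue_measure R).

Definition trunc_moment (i : nat) g u : R := \int[mu]_(y in `[0, u]) (y ^+ i * `|g y|).

Lemma integrable_trunc_moment i g u : lint g ->
  mu.-integrable `[0, u] (EFin \o (fun y => y ^+ i * `|g y|)).
Proof.
move=> ig; apply: (@integrable_bounded_mul _ _ _ _ (u ^+ i)) => //.
- move=> x /=; rewrite in_itv/= => /andP[x0 xu].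
  by rewrite ger0_norm ?exprn_ge0// lerXn2r// nnegrE (le_trans x0).
- exact: (integrable_norm (ig u)).
Qed.

(** Common form of the bounds below: a majorant quadratic in [y] is integrated against [|g|]. The
    weight [c] is constant in [y] but may depend on [u]. *)
Lemma conv_bound h g u (c a0 a1 a2 : R) : bounded_lint h -> lint g -> 0 <= c ->
  (forall y, 0 <= y <= u -> c * `|h (u - y)| <= a0 + a1 * y + a2 * y ^+ 2) ->
  c * `|conv h g u| <= a0 * trunc_moment 0 g u + a1 * trunc_moment 1 g u +
    a2 * trunc_moment 2 g u.
Proof.
move=> bh ig c0 H.
have ic := integrable_conv u bh ig.
have im i := integrable_trunc_moment i u ig.
have ima i (b : R) := integrable_cstM b (measurable_itv _) (im i).
apply: (@le_trans _ _ (c * \int[mu]_(y in `[0, u]) `|h (u - y) * g y|)).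
  by apply: ler_wpM2l => //; exact: le_normr_Rintegral.
have icn := integrable_norm ic.
rewrite -RintegralZl// /trunc_moment -!RintegralZl// -!RintegralD//; last first.
  exact: integrable_add (ima 0%N a0) (ima 1%N a1).
apply: le_Rintegral => //.
- exact: integrable_cstM icn.
- apply: integrable_add (ima 2%N a2) => //.
  exact: integrable_add (ima 0%N a0) (ima 1%N a1).
move=> y /=; rewrite in_itv/= => /H Hy.
rewrite normrM [leLHS]mulrA.
apply: (le_trans (ler_wpM2r (normr_ge0 (g y)) Hy)).
by rewrite le_eqVlt; apply/orP; left; apply/eqP; ring.
Qed.

(** The hypothesis is used at a point where [h] attains its maximum over [[0, u]]. That maximum is
    finite by compactness, so no bound on the whole half-line is presupposed. *)
Lemma contraction_bound h (q B : R) : q < 1 -> pcont h ->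
  (forall a S, (forall x, 0 <= x <= a -> h x <= S) ->
    forall u, 0 <= u <= a -> h u <= q * S + B) ->
  forall u, 0 <= u -> h u <= B / (1 - q).
Proof.
move=> q1 ch H u u0.
have [c cu hc] := EVT_max u0 (pcontW ch).
have cu' : 0 <= c <= u by move: cu; rewrite in_itv.
have hS x : 0 <= x <= u -> h x <= h c by move=> xu; apply: hc; rewrite in_itv.
have hcB := H u (h c) hS c cu'.
apply: (@le_trans _ _ (h c)).
  by apply: hc; rewrite in_itv/= u0 lexx.
by rewrite ler_pdivlMr ?subr_gt0//; lra.
Qed.

Lemma pcont_norm h : pcont h -> pcont (fun x => `|h x|).
Proof.
move=> /pcontP ch; apply/pcontP => x.
exact: (cvg_norm (ch x)).
Qed.

Lemma pcontX n : pcont (fun x : R => x ^+ n).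
Proof. by apply: continuous_subspaceT => x; exact: exprn_continuous. Qed.

(** The supremum norms leave out 0, whereas the estimates of convolutions evaluate there;
    right-continuity closes the gap. *)
Lemma pcont_bound0 h (A : R) : pcont h -> (forall x, 0 < x -> `|h x| <= A) ->
  forall x, 0 <= x -> `|h x| <= A.
Proof.
move=> ch hA x; rewrite le_eqVlt => /predU1P[<-|]; last exact: hA.
have /continuous_within_itvcyP[_ h0] := pcont_norm ch.
apply: (cvgr_to_le h0).
by near=> y; apply: hA; near: y; exact: nbhs_right_gt.
Unshelve. all: by end_near. Qed.

Section renewal_bounds.
Variables (phi : R) (f m w : R -> R).
Hypotheses (phi0 : 0 < phi) (phi1 : phi < 1).
Hypotheses (cm : pcont m) (lf : lint f).
Hypothesis f1 : forall u, 0 <= u -> trunc_moment 0 f u <= 1.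
Hypothesis mE : forall u, 0 <= u -> m u = phi * conv m f u + w u.

Let bm := pcont_bounded_lint cm.

(** A contraction with factor [phi], because the mass of [f] on [[0, u]] is at most 1. *)
Lemma renewal_bound (W : R) : (forall u, 0 <= u -> `|w u| <= W) ->
  forall u, 0 <= u -> `|m u| <= W / (1 - phi).
Proof.
move=> wW; apply: contraction_bound => //; first exact: pcont_norm.
move=> a S mS u /andP[u0 ua]; rewrite mE//.
apply: (le_trans (ler_normD _ _)); rewrite lerD ?wW// normrM gtr0_norm//.
rewrite ler_pM2l//.
have S0 : 0 <= S by apply: (le_trans _ (mS u _)); rewrite ?u0.
have := @conv_bound m f u 1 S 0 0 bm lf ler01.
rewrite !mul1r !mul0r !addr0 => H; apply: (le_trans (H _)).
  by move=> y /andP[y0 yu]; rewrite !mul0r !addr0 mul1r; apply: mS; lra.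
by rewrite ler_piMr// f1.
Qed.

(* Convexity, [u^2 <= (1 + e) (u - y)^2 + (1 + 1/e) y^2], with [e] so small
   that [phi (1 + e) < 1]: only the second moment of [f] is needed. *)
Lemma renewal_bound_sqr (W0 W2 K : R) :
  (forall u, 0 <= u -> `|w u| <= W0) ->
  (forall u, 0 <= u -> u ^+ 2 * `|w u| <= W2) ->
  (forall u, 0 <= u -> trunc_moment 2 f u <= K) ->
  exists C, forall u, 0 <= u -> u ^+ 2 * `|m u| <= C.
Proof.
move=> wW0 wW2 fK.
pose A := W0 / (1 - phi).
have mA : forall u, 0 <= u -> `|m u| <= A by exact: renewal_bound.
have A0 : 0 <= A by apply: (le_trans _ (mA 0 _)).
(* This choice makes [phi * (1 + e)] the midpoint between [phi] and 1. *)
pose e := (1 - phi) / (2 * phi).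
have e0 : 0 < e by rewrite divr_gt0// ?subr_gt0// mulr_gt0.
have qE : phi * (1 + e) = (1 + phi) / 2 by rewrite /e; field; rewrite gt_eqF.
(* The part with [y ^+ 2] needs only the bound [A] of [|m|] and the bound [K] of the second moment,
   so it goes into the constant. *)
pose B := phi * ((1 + e^-1) * A * K) + W2.
exists (B / (1 - phi * (1 + e))).
apply: (@contraction_bound (fun u => u ^+ 2 * `|m u|)).
- by rewrite qE; have := phi1; lra.
- by apply: pcontM; [exact: pcontX|exact: pcont_norm].
move=> a S mS u /andP[u0 ua].
have S0 : 0 <= S.
  by apply: (le_trans _ (mS u _)); rewrite ?u0// mulr_ge0// exprn_ge0.
have u20 : 0 <= u ^+ 2 by rewrite exprn_ge0.
rewrite mE// (le_trans (ler_wpM2l u20 (ler_normD _ _)))// mulrDr.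
rewrite /B addrA lerD ?wW2// normrM (gtr0_norm phi0) mulrCA -mulrA -mulrDr ler_pM2l//.
apply: (le_trans
  (@conv_bound m f u (u ^+ 2) ((1 + e) * S) 0 ((1 + e^-1) * A) bm lf u20 _)).
  move=> y /andP[y0 yu]; rewrite mul0r addr0.
  have uy : u ^+ 2 <= (1 + e) * (u - y) ^+ 2 + (1 + e^-1) * y ^+ 2.
    rewrite -subr_ge0.
    have -> : (1 + e) * (u - y) ^+ 2 + (1 + e^-1) * y ^+ 2 - u ^+ 2 =
        e * (u - y - e^-1 * y) ^+ 2.
      by field; rewrite gt_eqF.
    by rewrite mulr_ge0 ?sqr_ge0// ltW.
  apply: (le_trans (ler_wpM2r (normr_ge0 _) uy)).
  rewrite mulrDl lerD//.
    rewrite -mulrA ler_wpM2l//; first by rewrite addr_ge0// ltW.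
    by apply: mS; lra.
  rewrite mulrAC ler_wpM2r ?sqr_ge0// ler_wpM2l//.
    by rewrite addr_ge0// invr_ge0 ltW.
  by apply: mA; lra.
rewrite mul0r addr0 lerD//.
  by rewrite ler_piMr ?f1// mulr_ge0// addr_ge0// ltW.
rewrite ler_wpM2l ?fK// mulr_ge0// addr_ge0// invr_ge0 ltW//.
Qed.

End renewal_bounds.

(** Here [u ^+ 2] is expanded exactly instead of being estimated by convexity, which gives the
    coefficients 1, 2, 1 of the final inequalities. *)
Lemma conv_sqr_bound h g u (A0 A1 A2 : R) : bounded_lint h -> lint g -> 0 <= u ->
  (forall x, 0 <= x -> `|h x| <= A0) ->
  (forall x, 0 <= x -> x * `|h x| <= A1) ->
  (forall x, 0 <= x -> x ^+ 2 * `|h x| <= A2) ->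
  u ^+ 2 * `|conv h g u| <= A2 * trunc_moment 0 g u + 2 * A1 * trunc_moment 1 g u
     + A0 * trunc_moment 2 g u.
Proof.
move=> bh ig u0 h0 h1 h2; apply: conv_bound => //; first by rewrite exprn_ge0.
move=> y /andP[y0 yu].
have uy : 0 <= u - y by rewrite subr_ge0.
have -> : u ^+ 2 * `|h (u - y)| = (u - y) ^+ 2 * `|h (u - y)| +
   2 * ((u - y) * `|h (u - y)|) * y + `|h (u - y)| * y ^+ 2 by ring.
apply: lerD; first apply: lerD; first exact: h2.
  by rewrite ler_wpM2r// ler_wpM2l// h1.
by rewrite ler_wpM2r ?sqr_ge0// h0.
Qed.

End estimates.

(** * Moments and regularity of the data *)

Lemma sqr_le_step (R : realFieldType) (k x : R) :
  0 <= k -> k <= x -> x < k + 1 -> x ^+ 2 <= 2 * k ^+ 2 + 2.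
Proof.
move=> k0 kx xk.
have : x ^+ 2 <= (k + 1) ^+ 2 by rewrite ler_sqr ?nnegrE//; lra.
by have := sqr_ge0 (k - 1); rewrite !expr2; lra.
Qed.

Section density.
Context {R : realType} d (T : measurableType d) (P : probability T R).
Variables (Z : {RV P >-> R}) (f : R -> R).
Hypothesis Z_ge0 : forall t, 0 <= Z t.
Hypothesis Zf : is_density Z f.
Local Notation mu := (@lebesgue_measure R).

Let f0 x : 0 <= f x. Proof. by have [_ + _] := Zf; apply. Qed.

Let mf : measurable_fun [set: measurableTypeR R] f.
Proof. by have [+ _ _] := Zf. Qed.

Let mZ (A : set R) : measurable A -> measurable (Z @^-1` A).
Proof. by move=> mA; rewrite -[X in measurable X]setTI; exact: measurable_funPT. Qed.

Lemma density_lint : lint f.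
Proof.
move=> a; apply/integrableP; split.
  by apply/measurable_EFinP; exact: measurable_funTS.
have [_ _ /(_ `[0, a]%classic (measurable_itv _)) E] := Zf.
under eq_integral => x _ do rewrite /= ger0_norm//.
rewrite -E (@le_lt_trans _ _ 1%E) ?ltry//.
exact: (@probability_le1 _ _ _ (distribution P Z)).
Qed.

Lemma density_mass (u : R) : trunc_moment 0 f u <= 1.
Proof.
have [_ _ /(_ `[0, u]%classic (measurable_itv _)) E] := Zf.
rewrite -lee_fin /trunc_moment /Rintegral.
under eq_integral => x _ do rewrite /= expr0 mul1r ger0_norm//.
rewrite fineK; last exact: integrable_fin_num (density_lint u).
rewrite -E.
exact: (@probability_le1 _ _ _ (distribution P Z)).
Qed.

(** Were [f] zero on the open half-line, it would vanish at 0 too by continuity, and the nonnegative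
    [Z] would have total probability 0. The point found here is where measurability of [m] starts
    from. *)
Lemma density_gt0 : pcont f -> exists2 y, 0 < y & 0 < f y.
Proof.
move=> cf; apply: contrapT => H.
have fz y : 0 < y -> `|f y| <= 0.
  move=> y0; rewrite ger0_norm// leNgt; apply/negP => fy; apply: H.
  by exists y.
have fz' := pcont_bound0 cf fz.
have [_ _ /(_ `[0, +oo[%classic (measurable_itv _))] := Zf.
rewrite integral0_eq; last first.
  move=> x /=; rewrite in_itv/= andbT => /fz'.
  by rewrite normr_le0 => /eqP ->.
rewrite /distribution/= /pushforward/= [X in P X](_ : _ = setT); last first.
  by apply/seteqP; split => // t _ /=; rewrite in_itv/= Z_ge0.
by rewrite probability_setT => /eqP; rewrite eqe oner_eq0.
Qed.

(** A majorant of [2 * Z t ^+ 2 + 2], the excess being [2 * (Z t - 2 * c) ^+ 2]. With [c] the mean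
    of [Z], finite variance makes it integrable. *)
Let G (c : R) (t : T) : R := 4 * (Z t - c) ^+ 2 + (4 * c ^+ 2 + 2).

Let G0 c t : 0 <= G c t.
Proof. by rewrite /G; have := sqr_ge0 (Z t - c); have := sqr_ge0 c; lra. Qed.

Let mG c : measurable_fun [set: T] (G c).
Proof.
apply: measurable_funD => //; apply: measurable_funM => //.
by apply: measurable_funX => //; apply: measurable_funB => //.
Qed.

(** The density is given through probabilities of sets. On a slab of width 1 the square is at most
    the constant [2 * k%:R ^+ 2 + 2], so only the probability of the slab enters; and where [Z] lies
    in the slab, [G] exceeds this constant. *)
Let second_moment_slab (k : nat) (c : R) :
  (\int[mu]_(y in `[k%:R, k.+1%:R[) (y ^+ 2 * f y)%:E <=
   \int[P]_(t in Z @^-1` `[k%:R, k.+1%:R[) (G c t)%:E)%E.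
Proof.
pose C : R := 2 * k%:R ^+ 2 + 2.
have C0 : 0 <= C by rewrite addr_ge0// mulr_ge0// sqr_ge0.
have mI : measurable (Z @^-1` `[k%:R, k.+1%:R[) by apply: mZ; exact: measurable_itv.
have mfI : measurable_fun (`[k%:R, k.+1%:R[%classic : set (measurableTypeR R)) f.
  exact: measurable_funTS.
have Ik (x : R) : (x \in `[k%:R, k.+1%:R[%R) -> k%:R <= x /\ x < k%:R + 1.
  by rewrite in_itv/= -natr1 => /andP[].
apply: (@le_trans _ _ (\int[mu]_(y in `[k%:R, k.+1%:R[) (C%:E * (f y)%:E))%E).
  apply: ge0_le_integral => //.
  - by move=> x _; rewrite lee_fin mulr_ge0// sqr_ge0.
  - apply/measurable_EFinP; apply: measurable_funM => //.
  - apply/measurable_EFinP; exact: measurable_funM.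
  move=> x /Ik[x1 x2]; rewrite lee_fin ler_wpM2r//.
  exact: sqr_le_step.
rewrite ge0_integralZl//; last 2 first.
- exact/measurable_EFinP.
- by move=> x _; rewrite lee_fin.
have [_ _ /(_ `[k%:R, k.+1%:R[%classic (measurable_itv _)) <-] := Zf.
rewrite /distribution/= /pushforward/= -integral_cst//.
apply: ge0_le_integral => //.
- by apply/measurable_EFinP; exact: measurable_funTS.
move=> t /Ik[x1 x2]; rewrite lee_fin /C /G.
have : k%:R ^+ 2 <= Z t ^+ 2 by rewrite ler_sqr ?nnegrE.
by have := sqr_ge0 (Z t - 2 * c); rewrite !expr2; lra.
Qed.

Lemma density_second_moment : ('V_P[Z] < +oo)%E ->
  exists K, forall u, trunc_moment 2 f u <= K.
Proof.
rewrite /variance unlock; set c := fine ('E_P[Z])%E; rewrite unlock => V.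
have {}V : (\int[P]_t ((Z t - c) ^+ 2)%:E < +oo)%E by exact: V.
have K1 : (\int[P]_t (G c t)%:E < +oo)%E.
  rewrite (eq_integral (fun t => (4 * (Z t - c) ^+ 2)%:E + (4 * c ^+ 2 + 2)%:E)%E)//.
  rewrite ge0_integralD//; last 3 first.
  - by move=> t _; rewrite lee_fin mulr_ge0// sqr_ge0.
  - apply/measurable_EFinP; apply: measurable_funM => //.
    by apply: measurable_funX => //; apply: measurable_funB => //.
  - by move=> t _; rewrite lee_fin addr_ge0// mulr_ge0// sqr_ge0.
  rewrite lte_add_pinfty//.
    under eq_integral do rewrite EFinM.
    rewrite ge0_integralZl//; last 2 first.
    - apply/measurable_EFinP.
      by apply: measurable_funX => //; apply: measurable_funB => //.
    - by move=> t _; rewrite lee_fin sqr_ge0.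
    by rewrite lte_mul_pinfty.
  rewrite integral_cst// [X in (_ * X)%E](_ : _ = 1%E) ?mule1 ?ltry//.
  exact: probability_setT.
have mg : measurable_fun [set: measurableTypeR R] (fun y : R => (y ^+ 2 * f y)%:E).
  by apply/measurable_EFinP; apply: measurable_funM => //; exact: exprn_measurable.
have g0 (y : R) : (0 <= (y ^+ 2 * f y)%:E)%E by rewrite lee_fin mulr_ge0// sqr_ge0.
(* The slabs are added up by induction; a bound uniform in [N] suffices, since each truncated moment
   lies below some natural number. *)
have S (N : nat) : (\int[mu]_(y in `[0%R, N%:R[) (y ^+ 2 * f y)%:E <=
   \int[P]_(t in Z @^-1` `[0%R, N%:R[) (G c t)%:E)%E.
  elim: N => [|N IH].
    by rewrite set_itv_ge -?leNgt ?bnd_simp// integral_set0 preimage_set0 integral_set0.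
  have E : `[0%R, N.+1%:R[%classic =
      `[0%R, N%:R[%classic `|` `[N%:R, N.+1%:R[%classic :> set R.
    by rewrite -itv_bndbnd_setU// ?bnd_simp ?ler_nat.
  have dis : [disjoint `[0%R, N%:R[%classic & `[N%:R, N.+1%:R[%classic : set R].
    apply/disj_setPS => y [/=]; rewrite 2!in_itv/= => /andP[_ yx] /andP[].
    by rewrite leNgt yx.
  rewrite E preimage_setU ge0_integral_setU//; last first.
    exact: measurable_funTS.
  rewrite ge0_integral_setU//; first exact: leeD IH (second_moment_slab N c).
  - by apply: mZ; exact: measurable_itv.
  - by apply: mZ; exact: measurable_itv.
  - by apply/measurable_EFinP; exact: measurable_funTS.
  - by move=> t _; rewrite lee_fin.
  - move: dis; rewrite !disj_set2E => /eqP dis; apply/eqP.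
    by rewrite -preimage_setI dis preimage_set0.
pose K := fine (\int[P]_t (G c t)%:E).
have KE : (K%:E = \int[P]_t (G c t)%:E)%E.
  rewrite /K fineK// ge0_fin_numE//.
  by apply: integral_ge0 => t _; rewrite lee_fin.
exists K => u; rewrite -lee_fin KE.
rewrite /trunc_moment /Rintegral.
rewrite fineK; last exact: integrable_fin_num (integrable_trunc_moment 2 u density_lint).
under eq_integral => x _ do rewrite ger0_norm//.
have [N uN] : exists N : nat, u < N%:R.
  exists (Num.truncn u).+1; exact: truncnS_gt.
apply: (@le_trans _ _ (\int[mu]_(y in `[0%R, N%:R[) (y ^+ 2 * f y)%:E)%E).
  apply: ge0_subset_integral => //; first exact: measurable_funTS.
  by apply: subset_itvl; rewrite bnd_simp.
apply: (le_trans (S N)); apply: ge0_subset_integral => //.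
- by apply: mZ; exact: measurable_itv.
- exact/measurable_EFinP.
- by move=> t _; rewrite lee_fin.
Qed.

End density.

(** * Measurability and continuity of the solution *)

Section regularity.
Context {R : realType}.
Local Notation mu := (@lebesgue_measure R).
Local Notation RT := (measurableTypeR R).
Variables (f m : R -> R).
Hypothesis cf : pcont f.
Hypothesis im : forall u, 0 <= u ->
  mu.-integrable `[0, u] (fun y => (m (u - y) * f y)%:E).

Lemma measurable_fun_divr (D : set RT) (h k : R -> R) : measurable D ->
  {within D, continuous k} -> (forall x, D x -> k x != 0) ->
  measurable_fun D (fun x => h x * k x) -> measurable_fun D h.
Proof.
move=> mD ck k0 mhk.
have mk : measurable_fun D (fun x => (k x)^-1).
  apply: subspace_continuous_measurable_fun => //.
  rewrite continuous_subspace_in => x /set_mem xD.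
  by apply: cvgV; [exact: k0|exact: ck].
apply: (eq_measurable_fun (fun x => h x * k x * (k x)^-1)).
  by move=> x /set_mem xD; rewrite mulfK// k0.
exact: measurable_funM.
Qed.

Lemma measurable_fun_reflect_itv (p q u : R) (h : R -> R) :
  measurable_fun (`[p, q]%classic : set RT) (fun y => h (u - y)) ->
  measurable_fun (`[u - q, u - p]%classic : set RT) h.
Proof.
move=> mh.
have -> : h = (fun y => h (u - y)) \o (fun y => u - y).
  by apply/funext => y /=; rewrite opprB addrC subrK.
apply: (measurable_comp _ _ mh) => //.
  move=> _ [y + <-]; rewrite /= !in_itv/= => /andP[? ?].
  by apply/andP; split; lra.
by apply: measurable_funTS; exact: measurable_reflection.
Qed.

(* Where [f > 0], measurability of [y |-> m (u - y) f y] gives that of [m];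
   letting [u] vary, the windows so obtained cover the half-line. *)
Lemma renewal_measurable (y0 : R) : 0 < y0 -> 0 < f y0 ->
  forall a, measurable_fun (`[0, a]%classic : set RT) m.
Proof.
move=> y00 fy0.
have [e e0 eP] : exists2 e : R, 0 < e & forall y, `|y - y0| <= e -> 0 < y /\ 0 < f y.
  have : \forall y \near y0, 0 < y /\ 0 < f y.
    near=> y; split; near: y; first exact: lt_nbhsr.
    exact: (cvgr_gt _ (pcont_for cf y00)).
  move=> /nbhs_ballP[e /= e0 He]; exists (e / 2); first by rewrite divr_gt0.
  by move=> y ye; apply: He; rewrite /ball/= distrC (le_lt_trans ye)//; lra.
pose p := y0 - e; pose q := y0 + e.
have p0 : 0 < p.
  by have [] := eP p _; rewrite // /p addrAC subrr add0r normrN gtr0_norm.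
have pqP y : p <= y <= q -> 0 < f y.
  move=> /andP[py yq]; apply: (eP y _).2.
  by rewrite ler_norml; apply/andP; split; rewrite /p /q in py yq; lra.
(* As [y] runs through [[p, q]], where [f] is positive, [u - y] runs through a window of length
   [2 * e]. *)
have mw u : q <= u -> measurable_fun (`[u - q, u - p]%classic : set RT) m.
  move=> qu; apply: measurable_fun_reflect_itv.
  apply: (@measurable_fun_divr _ _ f) => //.
  - apply: continuous_subspaceW cf => x /=; rewrite !in_itv/= andbT => /andP[px _].
    exact: le_trans (ltW p0) px.
  - by move=> x /=; rewrite in_itv/= => /pqP; rewrite lt0r => /andP[].
  have u0 : 0 <= u by rewrite /q in qu; lra.
  have /measurable_int/measurable_EFinP := im u0.
  apply: measurable_funS => // x /=; rewrite !in_itv/= => /andP[px xq].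
  by apply/andP; split; lra.
have mn (n : nat) : measurable_fun (`[0, n%:R * (2 * e)]%classic : set RT) m.
  elim: n => [|n IH]; first by rewrite mul0r set_itv1; exact: measurable_fun_set1.
  have -> : `[0, n.+1%:R * (2 * e)]%classic =
      `[0, n%:R * (2 * e)]%classic `|`
      `[n%:R * (2 * e), n.+1%:R * (2 * e)]%classic :> set RT.
    have n0 : 0 <= n%:R * (2 * e) by rewrite mulr_ge0// mulr_ge0// ltW.
    rewrite -natr1; apply/seteqP; split => x /=; rewrite !in_itv/=.
      move=> /andP[x0 x1]; have [xn|xn] := leP x (n%:R * (2 * e)); [left|right].
        by rewrite x0.
      by rewrite ltW.
    by move=> [] /andP[? ?]; apply/andP; split; lra.
  apply/measurable_funU => //; split => //.
  (* For this [u] the window begins exactly where the previous one ended. *)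
  have := mw (q + n%:R * (2 * e)) _.
  have -> : q + n%:R * (2 * e) - q = n%:R * (2 * e) by ring.
  have -> : q + n%:R * (2 * e) - p = n.+1%:R * (2 * e).
    by rewrite -natr1 /q /p; ring.
  by apply; rewrite lerDl mulr_ge0// mulr_ge0// ltW.
move=> a.
pose n := (Num.truncn (a / (2 * e))).+1.
apply: measurable_funS (mn n) => // x /=; rewrite !in_itv/= => /andP[-> xa]/=.
rewrite (le_trans xa)// -ler_pdivrMr ?mulr_gt0//.
exact/ltW/truncnS_gt.
Unshelve. all: by end_near. Qed.

Lemma renewal_lint (y0 : R) : 0 < y0 -> 0 < f y0 -> locally_bounded m ->
  bounded_lint m.
Proof.
move=> y00 fy0 bm; split=> a.
  apply: measurable_bounded_integrable => //.
  - by rewrite /= lebesgue_measure_itv/=; case: ifPn; rewrite ltry.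
  - exact: renewal_measurable fy0 _.
have [M [Mr /(_ (`|M| + 1))]] := bm a.
have H : M < `|M| + 1 by rewrite (le_lt_trans (ler_norm _))// ltrDl.
move=> /(_ H) /= hM; by exists (`|M| + 1).
Qed.

(** After commuting the convolution, the continuous factor is [f], and local integrability of [m] is
    enough for the right-hand side to be continuous. *)
Lemma renewal_pcont (phi y0 : R) (v : R -> R) : 0 < y0 -> 0 < f y0 ->
  locally_bounded m -> pcont v ->
  (forall u, 0 <= u -> m u = phi * conv m f u + v u) -> pcont m.
Proof.
move=> y00 fy0 bm cv mE.
have lm := renewal_lint y00 fy0 bm.
apply: (@eq_pcont _ (fun u => phi * conv f m u + v u)).
  by move=> u u0; rewrite mE// (convC u lm)//; exact: pcont_lint.
apply: pcontD => //; apply: pcontZ; apply: pcont_conv => //; exact: lm.1.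
Qed.

End regularity.

(** * Weighted supremum norms *)

Section norms.
Context {R : realType}.
Implicit Types (g h : R -> R).
Local Notation mu := (@lebesgue_measure R).

Lemma supnorm_ub g (u : R) : 0 < u -> (`|g u|%:E <= supnorm g)%E.
Proof.
by move=> u0; apply: ereal_sup_ubound; exists u => //=; rewrite in_itv/= u0.
Qed.

Lemma supnorm_le g (c : R) : (forall u, 0 < u -> `|g u| <= c) ->
  (supnorm g <= c%:E)%E.
Proof.
move=> gc; apply: ge_ereal_sup => _ [u /= + <-].
by rewrite in_itv/= andbT => u0; rewrite lee_fin gc.
Qed.

Lemma supnorm_ltyP g : (supnorm g < +oo)%E <->
  exists2 c, supnorm g = c%:E & forall u, 0 < u -> `|g u| <= c.
Proof.
split=> [gy|[c -> _]]; last exact: ltry.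
have g0 : (0 <= supnorm g)%E.
  by apply: le_trans (supnorm_ub g ltr01); rewrite lee_fin.
have gE : supnorm g = (fine (supnorm g))%:E by rewrite fineK// ge0_fin_numE.
exists (fine (supnorm g)) => // u u0.
by rewrite -lee_fin -gE; exact: supnorm_ub.
Qed.

Lemma supnorm_lty g (c : R) : (forall u, 0 < u -> `|g u| <= c) ->
  (supnorm g < +oo)%E.
Proof. by move=> /supnorm_le /le_lt_trans; apply; exact: ltry. Qed.

Lemma eq_supnorm g h : (forall u, 0 < u -> g u = h u) -> supnorm g = supnorm h.
Proof.
move=> gh; congr ereal_sup; apply/seteqP; split=> _ [u /= u0 <-]; exists u => //;
  by move: u0; rewrite in_itv/= andbT => /gh ->.
Qed.

Lemma eq_wsupnorm j g h : (forall u, 0 < u -> g u = h u) ->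
  wsupnorm j g = wsupnorm j h.
Proof. by move=> gh; apply: eq_supnorm => u /gh ->. Qed.

Lemma wsupnorm_ltyP j g : (wsupnorm j g < +oo)%E <->
  exists2 c, wsupnorm j g = c%:E & forall u, 0 < u -> u ^+ j * `|g u| <= c.
Proof.
have E u : 0 < u -> `|u ^+ j * g u| = u ^+ j * `|g u|.
  by move=> u0; rewrite normrM ger0_norm// exprn_ge0// ltW.
split=> [/supnorm_ltyP[c gE cP]|[c cE cP]].
  by exists c => // u u0; rewrite -E// cP.
by apply/supnorm_ltyP; exists c => // u u0; rewrite E// cP.
Qed.

Lemma wsupnorm_le j g (c : R) : (forall u, 0 < u -> u ^+ j * `|g u| <= c) ->
  (wsupnorm j g <= c%:E)%E.
Proof.
move=> gc; apply: supnorm_le => u u0.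
by rewrite normrM ger0_norm ?gc// exprn_ge0// ltW.
Qed.

Lemma wsupnorm_lty j g (c : R) : (forall u, 0 < u -> u ^+ j * `|g u| <= c) ->
  (wsupnorm j g < +oo)%E.
Proof. by move=> /wsupnorm_le /le_lt_trans; apply; exact: ltry. Qed.

Lemma pcont_wbound0 j h (A : R) : pcont h ->
  (forall x, 0 < x -> x ^+ j * `|h x| <= A) ->
  forall x, 0 <= x -> x ^+ j * `|h x| <= A.
Proof.
move=> ch hA x x0.
have c1 : pcont (fun x => x ^+ j * `|h x|).
  by apply: pcontM; [exact: pcontX|exact: pcont_norm].
have E y : 0 <= y -> `|y ^+ j * `|h y| | = y ^+ j * `|h y|.
  by move=> y0; rewrite ger0_norm// mulr_ge0// exprn_ge0.
rewrite -E//; apply: (pcont_bound0 c1) => // y y0.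
by rewrite E ?hA// ltW.
Qed.

(** A bound on [w] comes from continuity on [[0, 1]] and from the weighted norm beyond 1, where
    [u ^+ 2] is at least 1. Weight 1 then follows from weights 0 and 2, as [u <= 1 + u ^+ 2]. *)
Lemma renewal_norms_lty (phi K : R) (f m w : R -> R) :
  0 < phi -> phi < 1 -> pcont m -> lint f ->
  (forall u, 0 <= u -> trunc_moment 0 f u <= 1) ->
  (forall u, 0 <= u -> trunc_moment 2 f u <= K) ->
  pcont w -> (wsupnorm 2 w < +oo)%E ->
  (forall u, 0 <= u -> m u = phi * conv m f u + w u) ->
  [/\ (supnorm m < +oo)%E, (wsupnorm 1 m < +oo)%E & (wsupnorm 2 m < +oo)%E].
Proof.
move=> phi0 phi1 cm lf f1 fK cw /wsupnorm_ltyP[W2 _ wW2] mE.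
have {}wW2 := pcont_wbound0 cw wW2.
have [C C0 wC] := pcont_bounded 1 cw.
have W20 : 0 <= W2 by apply: (le_trans _ (wW2 0 _)); rewrite // mulr_ge0// exprn_ge0.
have wW0 u : 0 <= u -> `|w u| <= C + W2.
  move=> u0; have [u1|u1] := leP u 1.
    by rewrite ler_wpDr// wC// u0.
  rewrite ler_wpDl//; apply: le_trans (wW2 u u0).
  by rewrite ler_peMl// exprn_ege1// ltW.
have mA := renewal_bound phi0 phi1 cm lf f1 mE wW0.
have [A2 mA2] := renewal_bound_sqr phi0 phi1 cm lf f1 mE wW0 wW2 fK.
split.
- by apply: supnorm_lty => u u0; exact/mA/ltW.
- apply: (@wsupnorm_lty _ _ ((C + W2) / (1 - phi) + A2)) => u u0.
  have ux : u <= 1 + u ^+ 2 by have := sqr_ge0 (u - 1); rewrite !expr2; nra.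
  apply: (@le_trans _ _ ((1 + u ^+ 2) * `|m u|)); first by rewrite expr1 ler_wpM2r.
  by rewrite mulrDl mul1r lerD ?mA ?mA2// ltW.
- by apply: (@wsupnorm_lty _ _ A2) => u u0; exact/mA2/ltW.
Qed.

(** * Absolute moments of a function continuous on the open half-line *)

Section moments.
Variable g : R -> R.
Hypothesis cg : forall x : R, 0 < x -> {for x, continuous g}.

Let mg : measurable_fun (`]0, +oo[%classic : set (measurableTypeR R)) g.
Proof.
apply: subspace_continuous_measurable_fun => //.
apply: continuous_in_subspaceT => x /set_mem/=; rewrite in_itv/= andbT => x0.
exact: cg.
Qed.

Let mg0 a : measurable_fun (`[0, a]%classic : set (measurableTypeR R)) g.
Proof.
apply: (measurable_funS (E := (`[0, +oo[%classic : set (measurableTypeR R)))) => //.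
  by apply: subset_itvl.
exact/measurable_fun_itv_obnd_cbndP.
Qed.

(** The point 0, where nothing is known of [g], is a null set. *)
Let moment_le i a : (\int[mu]_(y in `[0%R, a]) (y ^+ i * `|g y|)%:E <= absmoment i g)%E.
Proof.
have mga : measurable_fun (`]0, a]%classic : set (measurableTypeR R)) g.
  by apply: measurable_funS mg => //; apply: subset_itvl.
rewrite -integral_itv_obnd_cbnd; last first.
  apply/measurable_EFinP; apply: measurable_funM => //.
  exact: measurableT_comp.
apply: ge0_subset_integral => //.
- by apply/measurable_EFinP; apply: measurable_funM => //; exact: measurableT_comp.
- move=> x /=; rewrite in_itv/= andbT => x0.
  by rewrite lee_fin mulr_ge0// exprn_ge0// ltW.
- by apply: subset_itvl.
Qed.

Lemma absmoment_lint : (absmoment 0 g < +oo)%E -> lint g.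
Proof.
move=> gy a; apply/integrableP; split; first exact/measurable_EFinP.
apply: le_lt_trans gy; apply: le_trans (moment_le 0 a).
rewrite le_eqVlt; apply/orP; left; apply/eqP.
by apply: eq_integral => x _; rewrite /= expr0 mul1r.
Qed.

Lemma absmoment_ge0 i : (0 <= absmoment i g)%E.
Proof.
apply: integral_ge0 => x /=; rewrite in_itv/= andbT => x0.
by rewrite lee_fin mulr_ge0// exprn_ge0// ltW.
Qed.

Lemma absmoment_ltyP i : (absmoment i g < +oo)%E ->
  exists2 c, absmoment i g = c%:E & 0 <= c /\ forall u, trunc_moment i g u <= c.
Proof.
move=> gy; have g0 := absmoment_ge0 i.
have gE : absmoment i g = (fine (absmoment i g))%:E.
  by rewrite fineK// ge0_fin_numE.
exists (fine (absmoment i g)) => //; split=> [|u]; first exact: fine_ge0.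
have h0 : (0 <= \int[mu]_(y in `[0%R, u]) (y ^+ i * `|g y|)%:E)%E.
  apply: integral_ge0 => x /=; rewrite in_itv/= => /andP[x0 _].
  by rewrite lee_fin mulr_ge0// exprn_ge0.
apply: fine_le => //.
- by rewrite ge0_fin_numE//; exact: le_lt_trans (moment_le i u) gy.
- by rewrite ge0_fin_numE.
Qed.

(** Because [y <= 1 + y ^+ 2]. The first moment occurs in the final bounds, while finiteness is
    assumed for orders 0 and 2. *)
Lemma absmoment1_lty : (absmoment 0 g < +oo)%E -> (absmoment 2 g < +oo)%E ->
  (absmoment 1 g < +oo)%E.
Proof.
move=> g0 g2.
apply: (@le_lt_trans _ _ (absmoment 0 g + absmoment 2 g)%E); last exact: lte_add_pinfty.
have mgi i : measurable_fun (`]0, +oo[%classic : set (measurableTypeR R))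
    (fun y => (y ^+ i * `|g y|)%:E).
  by apply/measurable_EFinP; apply: measurable_funM => //; exact: measurableT_comp.
have gi i x : x \in `]0%R, +oo[%R -> (0 <= (x ^+ i * `|g x|)%:E)%E.
  by rewrite in_itv/= andbT => x0; rewrite lee_fin mulr_ge0// exprn_ge0// ltW.
rewrite /absmoment -ge0_integralD//; [|exact: gi|exact: gi].
apply: ge0_le_integral => //.
- exact: gi.
- exact: emeasurable_funD.
- move=> x x0; rewrite lee_fin -mulrDl ler_wpM2r//.
  by rewrite expr0 expr1; have := sqr_ge0 (x - 1); rewrite !expr2; nra.
Qed.

End moments.

(** Covers both final estimates. Capital letters stand for the iterated derivatives of the
    statement, small ones for explicit functions equal to them on the open half-line. All norms on
    the right being finite, the claim reduces to a pointwise inequality between reals. *)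
Lemma wsupnorm_convolution_bound (phi f00 f10 : R) (h k l w H K L W g : R -> R) :
  (forall u, 0 < u -> H u = h u) -> (forall u, 0 < u -> K u = k u) ->
  (forall u, 0 < u -> L u = l u) -> (forall u, 0 < u -> W u = w u) ->
  0 <= phi -> 0 <= f00 -> pcont h ->
  (forall x : R, 0 < x -> {for x, continuous g}) ->
  (absmoment 0 g < +oo)%E -> (absmoment 2 g < +oo)%E ->
  (supnorm h < +oo)%E -> (wsupnorm 1 h < +oo)%E -> (wsupnorm 2 h < +oo)%E ->
  (wsupnorm 2 k < +oo)%E -> (wsupnorm 2 W < +oo)%E ->
  (forall u, 0 < u -> l u = phi * (f00 * k u + f10 * h u + conv h g u) + w u) ->
  (wsupnorm 2 L <= phi%:E * ((absmoment 0 g + `|f10|%:E) * wsupnorm 2 H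
                + 2%:E * absmoment 1 g * wsupnorm 1 H
                + absmoment 2 g * supnorm H)
      + (phi * f00)%:E * wsupnorm 2 K + wsupnorm 2 W < +oo)%E.
Proof.
move=> Hh Kk Ll Ww phi0 f000 ch cg g0 g2 h0 h1 h2 k2 w2 lE.
rewrite (eq_wsupnorm 2 Ww) in w2 *.
rewrite !(eq_wsupnorm _ Hh) (eq_supnorm Hh) (eq_wsupnorm 2 Kk) (eq_wsupnorm 2 Ll).
have g1 := absmoment1_lty cg g0 g2.
have lg := absmoment_lint cg g0.
have [I0 -> [I00 gI0]] := absmoment_ltyP cg g0.
have [I1 -> [I10 gI1]] := absmoment_ltyP cg g1.
have [I2 -> [I20 gI2]] := absmoment_ltyP cg g2.
have /supnorm_ltyP[A0 -> hA0] := h0.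
have /wsupnorm_ltyP[A1 -> hA1] := h1.
have /wsupnorm_ltyP[A2 -> hA2] := h2.
have /wsupnorm_ltyP[B -> kB] := k2.
have /wsupnorm_ltyP[C -> wC] := w2.
rewrite -!(EFinD, EFinM) ltry andbT; apply: wsupnorm_le => u u0.
have {}hA0 := pcont_bound0 ch hA0.
have {}hA1 x : 0 <= x -> x * `|h x| <= A1.
  by move=> x0; rewrite -[x in x * _]expr1; exact: (pcont_wbound0 ch hA1).
have {}hA2' := pcont_wbound0 ch hA2.
have A00 : 0 <= A0 by apply: le_trans (hA0 0 _).
have A10 : 0 <= A1 by apply: le_trans (hA1 0 _); rewrite ?mul0r.
have A20 : 0 <= A2 by apply: le_trans (hA2' 0 _); rewrite // mulr_ge0// exprn_ge0.
have hg := conv_sqr_bound (pcont_bounded_lint ch) lg (ltW u0) hA0 hA1 hA2'.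
have {}hg : u ^+ 2 * `|conv h g u| <= I0 * A2 + 2 * I1 * A1 + I2 * A0.
  apply: (le_trans hg); rewrite (mulrC A2) (mulrC A0).
  have -> : 2 * A1 * trunc_moment 1 g u = 2 * trunc_moment 1 g u * A1 by ring.
  by rewrite !lerD// ler_wpM2r// ler_wpM2l.
have u2 : 0 <= u ^+ 2 by rewrite exprn_ge0// ltW.
have t1 : u ^+ 2 * `|f00 * k u| <= f00 * B.
  by rewrite normrM (ger0_norm f000) mulrCA ler_wpM2l// kB.
have t2 : u ^+ 2 * `|f10 * h u| <= `|f10| * A2.
  by rewrite normrM mulrCA ler_wpM2l// hA2.
rewrite lE//.
apply: (@le_trans _ _ (phi * (u ^+ 2 * `|f00 * k u| + u ^+ 2 * `|f10 * h u| +
    u ^+ 2 * `|conv h g u|) + u ^+ 2 * `|w u|)).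
  rewrite -!mulrDr [phi * (_ * _)]mulrCA -mulrDr ler_wpM2l//.
  apply: (le_trans (ler_normD _ _)); rewrite lerD2r normrM (ger0_norm phi0).
  rewrite ler_wpM2l//; apply: (le_trans (ler_normD _ _)); rewrite lerD2r.
  exact: ler_normD.
have -> : phi * ((I0 + `|f10|) * A2 + 2 * I1 * A1 + I2 * A0) + phi * f00 * B + C =
   phi * (f00 * B + `|f10| * A2 + (I0 * A2 + 2 * I1 * A1 + I2 * A0)) + C by ring.
by rewrite lerD ?wC// ler_wpM2l// !lerD.
Qed.

End norms.

(** * Derivatives on the half-line *)

Section halfline_derivatives.
Context {R : realType}.
Implicit Types (g h : R -> R).

Lemma derive1n_eq_gt0 g h : (forall x, 0 < x -> g x = h x) ->
  forall k x, 0 < x -> g^`(k) x = h^`(k) x.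
Proof.
move=> gh; elim=> [//|k IH] x x0; rewrite !derive1nS !derive1E.
by apply: near_eq_derive; exact: near_eq_gt0 IH x0.
Qed.

Lemma is_derive_derive1 g x (l : R) : is_derive x (1 : R) g l -> g^`() x = l.
Proof. by move=> [_ <-]; rewrite derive1E. Qed.

Lemma derivable_is_derive1 g x : derivable g x (1 : R) ->
  is_derive x (1 : R) g (g^`() x).
Proof. by move=> dg; rewrite derive1E; exact: derivableP. Qed.

Lemma is_derive_derivable g x (l : R) : is_derive x (1 : R) g l ->
  derivable g x (1 : R).
Proof. by move=> []. Qed.

Lemma ederiv_gt0 k g (u : R) : 0 < u -> ederiv k g u = g^`(k) u.
Proof. by move=> u0; rewrite /ederiv u0. Qed.

Lemma cvg_eq_gt0 g h (l : set_system R) : (forall x, 0 < x -> g x = h x) ->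
  g x @[x --> (0 : R)^'+] --> l -> h x @[x --> (0 : R)^'+] --> l.
Proof.
move=> gh; apply: cvg_trans; apply: near_eq_cvg.
by near=> x; apply: gh; near: x; exact: nbhs_right_gt.
Unshelve. all: by end_near. Qed.

Lemma pcont_ederiv k g : (forall u : R, 0 < u -> {for u, continuous g^`(k)}) ->
  cvg (g^`(k) x @[x --> (0 : R)^'+]) -> pcont (ederiv k g).
Proof.
move=> cg cg0; apply/continuous_within_itvcyP; split=> [x|].
  rewrite in_itv/= andbT => x0.
  have E : {near x, g^`(k) =1 ederiv k g}.
    by apply: near_eq_gt0 x0 => y y0; rewrite ederiv_gt0.
  rewrite /continuous_at ederiv_gt0//.
  by apply: cvg_trans (cg x x0); exact: near_eq_cvg.
rewrite [X in _ --> X](_ : _ = lim (g^`(k) x @[x --> (0 : R)^'+])); last first.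
  by rewrite /ederiv ltxx.
by apply: cvg_eq_gt0 cg0 => x x0; rewrite ederiv_gt0.
Qed.

(** Identifies a derivative at 0, defined as a limit, with the value of a continuous extension. *)
Lemma ederiv0_pcont k g h : (forall x, 0 < x -> g^`(k) x = h x) -> pcont h ->
  ederiv k g 0 = h 0.
Proof.
move=> gh /continuous_within_itvcyP[_ h0]; rewrite /ederiv ltxx.
by apply/cvg_lim => //; apply: cvg_eq_gt0 h0 => x x0; rewrite gh.
Qed.

End halfline_derivatives.

(** * The first two derivatives of the solution and their renewal equations *)

Section renewal_C2.
Context {R : realType}.
Implicit Types (g h : R -> R).

Lemma C0n2_ederiv g : C0n 2 g ->
  [/\ pcont g, pcont (ederiv 1 g) & pcont (ederiv 2 g)] /\
  [/\ forall u : R, 0 < u -> is_derive u 1 g (ederiv 1 g u) &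
      forall u : R, 0 < u -> is_derive u 1 (ederiv 1 g) (ederiv 2 g u)].
Proof.
move=> [[cg dg cg2] limg].
have d0 (u : R) : 0 < u -> is_derive u (1 : R) g (g^`() u).
  by move=> u0; apply: derivable_is_derive1; exact: (dg 0%N).
have d1 (u : R) : 0 < u -> is_derive u (1 : R) g^`(1) (g^`(2) u).
  by move=> u0; rewrite derive1nS; apply: derivable_is_derive1; exact: (dg 1%N).
split; split.
- exact: cg.
- apply: pcont_ederiv; last exact: limg.
  by move=> u u0; exact: is_derive_continuous (d1 u u0).
- by apply: pcont_ederiv; last exact: limg.
- by move=> u u0; rewrite ederiv_gt0//; exact: d0.
- move=> u u0; rewrite ederiv_gt0//.
  apply: is_derive_eq_gt0 (d1 u u0) => // x x0.
  by rewrite ederiv_gt0.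
Qed.

Lemma is_derive_lin (a : R) g h (u k l : R) :
  is_derive u (1 : R) g k -> is_derive u (1 : R) h l ->
  is_derive u (1 : R) (fun x => a * g x + h x) (a * k + l).
Proof.
move=> gk hl.
exact: (is_deriveD (is_deriveZ a gk) hl).
Qed.

Variables (phi : R) (f v m : R -> R).
Hypotheses (cf : pcont f) (cf1 : pcont (ederiv 1 f)).
Hypothesis df : forall u : R, 0 < u -> is_derive u 1 f (ederiv 1 f u).
Hypothesis Cv : C0n 2 v.
Hypothesis cm : pcont m.
Hypothesis mE : forall u, 0 <= u -> m u = phi * conv m f u + v u.

(** [renewal_derivative] is applied to [m], then to [m1] with forcing term [W1]. [W1] and [W2]
    extend [w1] and [w2] continuously to 0, where the two-sided derivatives in the latter carry no
    information; hence the identities for [0 < u]. *)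
Lemma renewal_C2 : exists m1 m2 : R -> R,
  let W1 u := phi * m 0 * f u + ederiv 1 v u in
  let W1' u := phi * m 0 * ederiv 1 f u + ederiv 2 v u in
  let W2 u := phi * m1 0 * f u + W1' u in
  [/\ pcont m1, pcont m2, pcont W1 & pcont W2] /\
  [/\ forall u : R, 0 < u -> is_derive u 1 m (m1 u),
      forall u : R, 0 < u -> is_derive u 1 m1 (m2 u) &
      forall u : R, 0 < u -> is_derive u 1 W1 (W1' u)] /\
  [/\ forall u, 0 <= u -> m1 u = phi * conv m1 f u + W1 u,
      forall u, 0 <= u -> m2 u = phi * conv m2 f u + W2 u,
      forall u, 0 < u -> w1 phi f v m u = W1 u &
      forall u, 0 < u -> w2 phi f v m u = W2 u].
Proof.
have [[cv cv1 cv2] [dv dv1]] := C0n2_ederiv Cv.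
have [m1 [cm1 dm m1E]] := renewal_derivative cm cf cf1 cv1 df dv mE.
pose W1 u := phi * m 0 * f u + ederiv 1 v u.
pose W1' u := phi * m 0 * ederiv 1 f u + ederiv 2 v u.
have cW1 : pcont W1 := pcontD (pcontZ (c := phi * m 0) cf) cv1.
have cW1' : pcont W1' := pcontD (pcontZ (c := phi * m 0) cf1) cv2.
have dW1 (u : R) : 0 < u -> is_derive u (1 : R) W1 (W1' u).
  by move=> u0; exact: (is_derive_lin (phi * m 0) (df u0) (dv1 u u0)).
have [m2 [cm2 dm1 m2E]] := renewal_derivative cm1 cf cf1 cW1' df dW1 m1E.
have w1E (u : R) : 0 < u -> w1 phi f v m u = W1 u.
  by move=> u0; rewrite /w1 /W1 ederiv_gt0.
exists m1, m2; split.
  by split; [exact: cm1|exact: cm2|exact: cW1|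
             exact: (pcontD (pcontZ (c := phi * m1 0) cf) cW1')].
split; first by split; [exact: dm|exact: dm1|exact: dW1].
split; [exact: m1E|exact: m2E|exact: w1E|].
move=> u u0; rewrite /w2.
rewrite (ederiv0_pcont (h := m1))//; last first.
  by move=> x x0; exact: is_derive_derive1 (dm x x0).
congr (_ + _).
have := derive1n_eq_gt0 w1E 1 u0.
rewrite /= => ->; exact: is_derive_derive1 (dW1 u u0).
Qed.

End renewal_C2.

(** * Assembly of the two claims *)

Local Open Scope ereal_scope.
Unset Implicit Arguments.

Theorem proposition2p4 (R : realType) (d : measure_display)
    (T : measurableType d) (P : probability T R) (Z : {RV P >-> R})
    (phi : R) (f v m : R -> R)
    (phi_gt0 : (0 < phi)%R) (phi_lt1 : (phi < 1)%R)
    (Z_ge0 : forall t, (0 <= Z t)%R)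
    (F0 : cdfR Z 0 = 0%R)
    (f_density : is_density Z f)
    (* the version of the density that is used when F is in C^2_0 *)
    (f_version : C0n 2 (cdfR Z) ->
      forall u : R, (0 <= u)%R -> f u = ederiv 1 (cdfR Z) u)
    (v_bounded : locally_bounded v)
    (m_bounded : locally_bounded m)
    (m_renewal : renewal_solution phi f v m) :
  (C0n 2 (cdfR Z) -> C0n 2 v ->
   supnorm (w2 phi f v m) < +oo ->
   deriv_exists 2 m /\
   supnorm m^`(2) <= supnorm (w2 phi f v m) / (1 - phi)%:E < +oo)
  /\
  ('V_P[Z] < +oo ->
   C0n 2 (cdfR Z) -> C0n 2 v ->
   Cn 2 (ederiv 1 f) -> Cn 2 (ederiv 2 v) ->
   absmoment 0 f^`(2) < +oo -> absmoment 2 f^`(2) < +oo ->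
   wsupnorm 2 (w1 phi f v m) < +oo -> wsupnorm 2 (w2 phi f v m) < +oo ->
   wsupnorm 2 (w1 phi f v m)^`(2) < +oo ->
   wsupnorm 2 (w2 phi f v m)^`(2) < +oo ->
   deriv_exists 4 m /\
   (wsupnorm 2 m^`(3) <=
      phi%:E * ((absmoment 0 f^`(2) + `|ederiv 1 f 0|%:E) * wsupnorm 2 m^`()
                + 2%:E * absmoment 1 f^`(2) * wsupnorm 1 m^`()
                + absmoment 2 f^`(2) * supnorm m^`())
      + (phi * f 0%R)%:E * wsupnorm 2 m^`(2)
      + wsupnorm 2 (w1 phi f v m)^`(2) < +oo) /\
   (wsupnorm 2 m^`(4) <=
      phi%:E * ((absmoment 0 f^`(2) + `|ederiv 1 f 0|%:E) * wsupnorm 2 m^`(2)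
                + 2%:E * absmoment 1 f^`(2) * wsupnorm 1 m^`(2)
                + absmoment 2 f^`(2) * supnorm m^`(2))
      + (phi * f 0%R)%:E * wsupnorm 2 m^`(3)
      + wsupnorm 2 (w2 phi f v m)^`(2) < +oo)).
Proof.
have f0 (x : R) : (0 <= f x)%R by have [_ + _] := f_density; apply.
have fmass (u : R) : (0 <= u)%R -> (trunc_moment 0 f u <= 1)%R.
  by move=> _; exact: (density_mass f_density).
have base : C0n 2 (cdfR Z) -> C0n 2 v ->
    [/\ pcont f, pcont (ederiv 1 f), pcont m,
      forall u : R, (0 < u)%R -> is_derive u (1 : R)%R f (ederiv 1 f u) &
      forall u : R, (0 <= u)%R -> m u = (phi * conv m f u + v u)%R].
  move=> CF Cv.
  have [[_ cF1 cF2] [_ dF1]] := C0n2_ederiv CF.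
  have fE := f_version CF.
  (* The chosen version of the density makes [f] and its derivative inherit continuity up to 0 from
     the first two derivatives of the distribution function. *)
  have cf : pcont f by apply: eq_pcont cF1 => x x0; rewrite fE.
  have df (u : R) : (0 < u)%R -> is_derive u (1 : R)%R f (ederiv 2 (cdfR Z) u).
    move=> u0; apply: is_derive_eq_gt0 (dF1 u u0) => // x x0.
    by rewrite fE// ltW.
  have f1E (u : R) : (0 < u)%R -> f^`() u = ederiv 2 (cdfR Z) u.
    by move=> u0; exact: is_derive_derive1 (df u u0).
  have cf1 : pcont (ederiv 1 f).
    apply: (eq_pcont _ cF2) => u; rewrite le_eqVlt => /predU1P[<-|u0].
      by rewrite (@ederiv0_pcont _ 1 f _ f1E cF2).
    by rewrite [RHS]ederiv_gt0// -f1E.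
  have mE (u : R) : (0 <= u)%R -> m u = (phi * conv m f u + v u)%R.
    by move=> u0; have [_ ->] := m_renewal u u0.
  have im (u : R) : (0 <= u)%R -> (@lebesgue_measure R).-integrable `[0%R, u]%classic
      (fun y => (m (u - y) * f y)%:E).
    by move=> u0; have [+ _] := m_renewal u u0.
  have [y y0 fy] := density_gt0 Z_ge0 f_density cf.
  have [[cv _ _] _] := C0n2_ederiv Cv.
  have cm := renewal_pcont cf im y0 fy m_bounded cv mE.
  split; [exact: cf|exact: cf1|exact: cm| |exact: mE].
  move=> u u0; rewrite (ederiv_gt0 _ _ u0) derive1nS derive1n0.
  by apply: derivable_is_derive1; exact: is_derive_derivable (df u u0).
split.
  move=> CF Cv /supnorm_ltyP[S SE w2S].
  have [cf cf1 cm df mE] := base CF Cv.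
  have [m1 [m2 [[cm1 cm2 _ cW2] [[dm dm1 _] [m1E m2E _ w2E]]]]] :=
    renewal_C2 cf cf1 df Cv cm mE.
  have m1d (u : R) : (0 < u)%R -> m^`() u = m1 u.
    by move=> u0; exact: is_derive_derive1 (dm u u0).
  have dm1' (u : R) : (0 < u)%R -> is_derive u (1 : R)%R m^`() (m2 u).
    by move=> u0; apply: is_derive_eq_gt0 (dm1 u u0) => // x x0; rewrite m1d.
  have m2d (u : R) : (0 < u)%R -> m^`(2) u = m2 u.
    by move=> u0; exact: is_derive_derive1 (dm1' u u0).
  split.
    case=> [_ u u0|[_ u u0|//]]; first exact: is_derive_derivable (dm u u0).
    exact: is_derive_derivable (dm1' u u0).
  (* As [1 - phi] is nonzero, the quotient of extended reals is a quotient of reals. *)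
  rewrite SE inver ifF; last by rewrite subr_eq0 gt_eqF.
  rewrite -EFinM ltry andbT; apply: supnorm_le => u u0.
  rewrite m2d//.
  apply: (renewal_bound phi_gt0 phi_lt1 cm2 (pcont_lint cf) fmass m2E); last exact: ltW.
  apply: pcont_bound0 => // x x0.
  by rewrite -w2E// w2S.
move=> V CF Cv [_ df1 _] [_ dv2 _] I0 I2 nw1 nw2 nw1'' nw2''.
have [cf cf1 cm df mE] := base CF Cv.
have [K fK] := density_second_moment Z_ge0 f_density V.
have [m1 [m2 [[cm1 cm2 cW1 cW2] [[dm dm1 dW1] [m1E m2E w1E w2E]]]]] :=
  renewal_C2 cf cf1 df Cv cm mE.
pose f2 : R -> R := f^`(2).
pose f3 : R -> R := f^`(3).
pose v3 : R -> R := (ederiv 2 v)^`().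
pose v4 : R -> R := v3^`().
pose W1 u := (phi * m 0 * f u + ederiv 1 v u)%R.
pose W1' u := (phi * m 0 * ederiv 1 f u + ederiv 2 v u)%R.
(* On the open half-line, [W1''] and [W2''] are the second derivatives of [w1] and [w2]; they
   involve [f] up to order 3 and [v] up to order 4. *)
pose W1'' u := (phi * m 0 * f2 u + v3 u)%R.
pose W2 u := (phi * m1 0 * f u + W1' u)%R.
pose W2' u := (phi * m1 0 * ederiv 1 f u + W1'' u)%R.
pose W2'' u := (phi * m1 0 * f2 u + (phi * m 0 * f3 u + v4 u))%R.
have f1E (x : R) : (0 < x)%R -> ederiv 1 f x = f^`(1) x by exact: ederiv_gt0.
have f2E (x : R) : (0 < x)%R -> (ederiv 1 f)^`() x = f2 x.
  by move=> x0; exact: (derive1n_eq_gt0 f1E 1 x0).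
have df1' (u : R) : (0 < u)%R -> is_derive u (1 : R)%R (ederiv 1 f) (f2 u).
  by move=> u0; rewrite -(f2E u u0); exact: (derivable_is_derive1 (df1 0%N isT u u0)).
have df2 (u : R) : (0 < u)%R -> is_derive u (1 : R)%R f2 (f3 u).
  move=> u0; rewrite /f3 derive1nS; apply: derivable_is_derive1.
  apply: (near_eq_derivable (near_eq_gt0 f2E u0)).
  exact: (df1 1%N isT u u0).
have cf2 (x : R) : (0 < x)%R -> {for x, continuous f2}.
  by move=> x0; exact: is_derive_continuous (df2 x x0).
have if2 := absmoment_lint cf2 I0.
have dv3 (u : R) : (0 < u)%R -> is_derive u (1 : R)%R (ederiv 2 v) (v3 u).
  by move=> u0; exact: (derivable_is_derive1 (dv2 0%N isT u u0)).
have dv4 (u : R) : (0 < u)%R -> is_derive u (1 : R)%R v3 (v4 u).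
  by move=> u0; exact: (derivable_is_derive1 (dv2 1%N isT u u0)).
have dW1' (u : R) : (0 < u)%R -> is_derive u (1 : R)%R W1' (W1'' u).
  by move=> u0; exact: (is_derive_lin (phi * m 0)%R (df1' u u0) (dv3 u u0)).
have dW2 (u : R) : (0 < u)%R -> is_derive u (1 : R)%R W2 (W2' u).
  by move=> u0; exact: (is_derive_lin (phi * m1 0)%R (df u u0) (dW1' u u0)).
have dW2' (u : R) : (0 < u)%R -> is_derive u (1 : R)%R W2' (W2'' u).
  move=> u0; apply: (is_derive_lin (phi * m1 0)%R (df1' u u0)).
  exact: (is_derive_lin (phi * m 0)%R (df2 u u0) (dv4 u u0)).
(* Both formulas have the kernel differentiated twice: [m3] comes from the equation of [m1], and
   [m4] from that of [m2] rather than from the formula for [m3]. *)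
pose m3 u := (phi * (f 0 * m2 u + ederiv 1 f 0 * m1 u + conv m1 f2 u) + W1'' u)%R.
pose m4 u := (phi * (f 0 * m3 u + ederiv 1 f 0 * m2 u + conv m2 f2 u) + W2'' u)%R.
have dm2 (u : R) : (0 < u)%R -> is_derive u (1 : R)%R m2 (m3 u).
  move=> u0.
  exact: (renewal_derivative2 cm1 cf cf1 if2 df df1' cf2 dm1 dW1 m1E u0
    (dW1' u u0)).
have dm3 (u : R) : (0 < u)%R -> is_derive u (1 : R)%R m3 (m4 u).
  move=> u0.
  exact: (renewal_derivative2 cm2 cf cf1 if2 df df1' cf2 dm2 dW2 m2E u0
    (dW2' u u0)).
(* Transfers the derivatives from [m1], [m2], [m3], [m4] to the iterated derivatives of [m], one
   order at a time, since the functions agree on the open half-line only. *)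
have dstep k (g l : R -> R) : (forall x, (0 < x)%R -> m^`(k) x = g x) ->
    (forall x : R, (0 < x)%R -> is_derive x (1 : R)%R g (l x)) ->
    (forall x : R, (0 < x)%R -> is_derive x (1 : R)%R m^`(k) (l x)) /\
    (forall x, (0 < x)%R -> m^`(k.+1) x = l x).
  move=> mg dg.
  have H (x : R) : (0 < x)%R -> is_derive x (1 : R)%R m^`(k) (l x).
    by move=> x0; apply: is_derive_eq_gt0 (dg x x0) => // y y0; rewrite mg.
  split=> // x x0; rewrite derive1nS.
  exact: is_derive_derive1 (H x x0).
have [dm_0 mE1] := dstep 0%N m m1 (fun _ _ => erefl) dm.
have [dm_1 mE2] := dstep 1%N m1 m2 mE1 dm1.
have [dm_2 mE3] := dstep 2%N m2 m3 mE2 dm2.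
have [dm_3 mE4] := dstep 3%N m3 m4 mE3 dm3.
have w1''E (u : R) : (0 < u)%R -> (w1 phi f v m)^`(2) u = W1'' u.
  move=> u0; rewrite (derive1n_eq_gt0 w1E 2 u0).
  have W1E (x : R) : (0 < x)%R -> W1^`() x = W1' x.
    by move=> x0; exact: is_derive_derive1 (dW1 x x0).
  rewrite derive1Sn (derive1n_eq_gt0 W1E 1 u0).
  exact: is_derive_derive1 (dW1' u u0).
have w2''E (u : R) : (0 < u)%R -> (w2 phi f v m)^`(2) u = W2'' u.
  move=> u0; rewrite (derive1n_eq_gt0 w2E 2 u0).
  have W2E (x : R) : (0 < x)%R -> W2^`() x = W2' x.
    by move=> x0; exact: is_derive_derive1 (dW2 x x0).
  rewrite derive1Sn (derive1n_eq_gt0 W2E 1 u0).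
  exact: is_derive_derive1 (dW2' u u0).
have nW1 : wsupnorm 2 W1 < +oo by rewrite -(eq_wsupnorm 2 w1E).
have nW2 : wsupnorm 2 W2 < +oo by rewrite -(eq_wsupnorm 2 w2E).
have fK' (u : R) : (0 <= u)%R -> (trunc_moment 2 f u <= K)%R by move=> _; exact: fK.
have lf := pcont_lint cf.
have [n10 n11 n12] :=
  renewal_norms_lty phi_gt0 phi_lt1 cm1 lf fmass fK' cW1 nW1 m1E.
have [n20 n21 n22] :=
  renewal_norms_lty phi_gt0 phi_lt1 cm2 lf fmass fK' cW2 nW2 m2E.
have b3 := wsupnorm_convolution_bound mE1 mE2 mE3 w1''E (ltW phi_gt0) (f0 0%R)
  cm1 cf2 I0 I2 n10 n11 n12 n22 nw1'' (fun u _ => erefl (m3 u)).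
(* The first estimate supplies the finiteness of the norm of the third derivative that the second
   one has on its right-hand side. *)
have n3 : wsupnorm 2 m3 < +oo.
  rewrite -(eq_wsupnorm 2 mE3); have /andP[b3l b3r] := b3.
  exact: le_lt_trans b3l b3r.
have b4 := wsupnorm_convolution_bound mE2 mE3 mE4 w2''E (ltW phi_gt0) (f0 0%R)
  cm2 cf2 I0 I2 n20 n21 n22 n3 nw2'' (fun u _ => erefl (m4 u)).
split; last by split; [exact: b3|exact: b4].
case=> [|[|[|[|k]]]] k4 u u0.
- exact: is_derive_derivable (dm_0 u u0).
- exact: is_derive_derivable (dm_1 u u0).
- exact: is_derive_derivable (dm_2 u u0).
- exact: is_derive_derivable (dm_3 u u0).
- by case: (notF k4).
Qed.
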